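(* Let $\Bbbk$ be a field extension of $\mathbb{C}$ and let $\Delta$ be a simplicial complex on vertex set $\{1,\dots,n\}$ with a free action by a finite abelian group $G$. Then for all integers $i$ and all integers $j\ge 0$, the Hochster–Gräbe isomorphism of $\Bbbk$-vector spaces $$H_{\mathfrak m}^i(\Bbbk[\Delta])_{-j}\;\cong\; \bigoplus_{U\in T(\Delta)_j}H^{i-1}(\Delta, \mathrm{cost}_\Delta\, s(U))$$ (described in the context) induces, for each irreducible character $\chi$ of $G$, an isomorphism of $\Bbbk$-vector spaces $$H_{\mathfrak m}^i(\Bbbk[\Delta])_{-j}^{\chi}\;\cong\; \left[\bigoplus_{U\in T(\Delta)_j}H^{i-1}(\Delta, \mathrm{cost}_\Delta\, s(U))\right]^{\chi^{-1}}.$$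
   Context: A simplicial complex $\Delta$ on $[n]=\{1,\dots,n\}$ is a collection of subsets of $[n]$ (faces) closed under inclusion. For a face $\sigma$, $\mathrm{cost}_\Delta\,\sigma=\{\tau\in\Delta:\sigma\not\subset\tau\}$. $H^{i}(\Delta,\Gamma)$ is relative simplicial cohomology with coefficients in $\Bbbk$, computed with the empty face included (degree $-1$), so $H^i(\Delta,\{\emptyset\})$ and $H^i(\Delta,\emptyset)=H^i(\Delta,\mathrm{cost}_\Delta\,\emptyset)$ are to be read as reduced cohomology $\tilde H^i(\Delta)$. For $U=(u_1,\dots,u_n)\in\mathbb{N}^n$ put $s(U)=\{k:u_k>0\}$ and $|U|=\sum_k u_k$; $T(\Delta)_j=\{U\in\mathbb{N}^n: s(U)\in\Delta,\ |U|=j\}$. Let $A=\Bbbk[x_1,\dots,x_n]$, $\mathfrak m=(x_1,\dots,x_n)$, and $\Bbbk[\Delta]=A/I_\Delta$ with $I_\Delta=(\prod_{i\in\sigma}x_i:\sigma\subset[n],\ \sigma\notin\Delta)$. $H^i_{\mathfrak m}$ denotes local cohomology; it is $\mathbb{Z}$-graded and a subscript denotes the graded component. $G$ acts on $\Delta$ by simplicial automorphisms; the action is free if $g\cdot\sigma\neq\sigma$ for every nonempty face $\sigma$ and every $g\ne 1$ in $G$. $G$ acts on $A$ and $\Bbbk[\Delta]$ by $g\cdot x_v=x_{g\cdot v}$, and hence functorially on each $H^i_{\mathfrak m}(\Bbbk[\Delta])_{-j}$. $G$ acts on $\bigoplus_{U\in T(\Delta)_j}H^{i-1}(\Delta,\mathrm{cost}_\Delta\,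 s(U))$ by pullback of cochains, $(g\cdot c)(\tau)=c(g\cdot\tau)$ for oriented simplices $\tau$, which sends the summand indexed by $U$ to the summand indexed by $g^{-1}\cdot U$, where $(g\cdot U)_{g\cdot v}=U_v$; since $G$ is abelian this is a $\Bbbk[G]$-module structure. For a $\Bbbk[G]$-module $N$ and an irreducible (one-dimensional) character $\chi$, $N^\chi=\{n\in N: g\cdot n=\chi(g)n\ \text{for all } g\in G\}$, and $\chi^{-1}(g)=\chi(g)^{-1}$. The Hochster–Gräbe isomorphism: let $\mathfrak m_{j+1}=(x_1^{j+1},\dots,x_n^{j+1})$ and let $K_\bullet$ be the Koszul complex of $A$ on $x_1^{j+1},\dots,x_n^{j+1}$, where $K_t$ is free on the elements $\overline x_\rho=x_{i_1}^{j+1}\wedge\cdots\wedge x_{i_t}^{j+1}$, $\rho=\{i_1<\cdots<i_t\}\subset[n]$. One has $H^i_{\mathfrak m}(\Bbbk[\Delta])_{-j}=\mathrm{Ext}^i_A(A/\mathfrak m_{j+1},\Bbbk[\Delta])_{-j}=H^i(\mathrm{Hom}_A(K_\bullet,\Bbbk[\Delta])_{-j})$. The cochain space $C^{t-1}(\Delta,\mathrm{cost}_\Delta\, s(U))$ has as basis the dual classes $\widehat\sigma$ of the faces $\sigma\in\Delta$ with $|\sigma|=t$ and $s(U)\subset\sigma$ (oriented by the order of $[n]$). The isomorphism is the one induced on cohomology by the chain map sending $\widehat\sigma$ in the summand $U$ to the homomorphism $f^U_{\sigma,\sigma}$ with $f^U_{\sigma,\sigma}(\overline x_\sigma)=\big(\prod_{k\in\sigma}x_k^{j+1}\big)/\big(\prod_k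 x_k^{u_k}\big)$ and $f^U_{\sigma,\sigma}(\overline x_\rho)=0$ for $\rho\ne\sigma$. *)

(* Defs.v *)
From HB Require Import structures.
From mathcomp Require Import all_boot all_order all_algebra all_fingroup all_character.
From mathcomp Require Import generic_quotient ring_quotient.
From mathcomp Require Import boolp mpoly.

Set Implicit Arguments.
Unset Strict Implicit.
Unset Printing Implicit Defensive.

Import Order.TTheory GRing.Theory Num.Theory.

Local Open Scope ring_scope.
Local Open Scope quotient_scope.

Section Modules.
Variable R : pzRingType.
Implicit Types V W : lmodType R.

Record submodule V := Submodule {
  submodule_pred :> {pred V};
  submodule_closed : submod_closed submodule_pred }.

HB.instance Definition _ V (Z : submodule V) :=
  GRing.isSubmodClosed.Build R V (submodule_pred Z) (submodule_closed Z).

Definition submod V (Z : submodule V) := {v : V | v \in Z}.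

HB.instance Definition _ V (Z : submodule V) := SubChoice.on (submod Z).
HB.instance Definition _ V (Z : submodule V) :=
  [SubChoice_isSubLmodule of submod Z by <:].

Definition quotmod V (B : submodule V) := Quotient.quot B.

Section Quotmod.
Variables (V : lmodType R) (B : submodule V).

HB.instance Definition _ := GRing.Zmodule.on (quotmod B).

Definition qclass (v : V) : quotmod B := \pi v.
Definition qrepr (x : quotmod B) : V := repr x.

Lemma qreprK : cancel qrepr qclass.
Proof. exact: reprK. Qed.

Lemma qclass_eq u v : (qclass u == qclass v) = (u - v \in B).
Proof. by rewrite Quotient.idealrBE. Qed.

Lemma qclassD : {morph qclass : u v / u + v}.
Proof. by move=> u v; rewrite /qclass piE. Qed.

Definition qscale (a : R) (x : quotmod B) : quotmod B := qclass (a *: qrepr x).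

Lemma qclassZ a v : qclass (a *: v) = qscale a (qclass v).
Proof.
apply/eqP; rewrite qclass_eq -scalerBr rpredZ //.
by rewrite -qclass_eq qreprK.
Qed.

Fact qscaleA a b x : qscale a (qscale b x) = qscale (a * b) x.
Proof. by rewrite -[x]qreprK -!qclassZ scalerA. Qed.
Fact qscale1 : left_id 1 qscale.
Proof. by move=> x; rewrite -[x]qreprK -qclassZ scale1r. Qed.
Fact qscaleDr : right_distributive qscale +%R.
Proof.
by move=> a x y; rewrite -[x]qreprK -[y]qreprK -qclassD -!qclassZ -qclassD scalerDr.
Qed.
Fact qscaleDl x : {morph qscale^~ x : a b / a + b}.
Proof. by move=> a b; rewrite -[x]qreprK -!qclassZ -qclassD scalerDl. Qed.

HB.instance Definition _ := GRing.Zmodule_isLmodule.Build R (quotmod B)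
  qscaleA qscale1 qscaleDr qscaleDl.

Fact qclass_linear : linear qclass.
Proof. by move=> a u v; rewrite qclassD qclassZ. Qed.
HB.instance Definition _ := GRing.isLinear.Build R V (quotmod B) _ qclass qclass_linear.

End Quotmod.

Section Subquotient.
Variables (V : lmodType R) (Z B : submodule V).

Definition trace_pred : {pred submod Z} := [pred z | val z \in B].
Fact trace_submod : submod_closed trace_pred.
Proof.
split=> [|a u v]; rewrite !inE ?GRing.val0 ?rpred0 // => uB vB.
by rewrite linearP rpredD ?rpredZ.
Qed.
Definition trace := Submodule trace_submod.

(* Z / (B \cap Z) *)
Definition subquot := quotmod trace.
HB.instance Definition _ := GRing.Lmodule.on subquot.

(* meaningful for v \in Z; other v are sent to 0 *)
Definition sqclass (v : V) : subquot := qclass trace (insubd 0 v).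
Definition sqrepr (x : subquot) : V := val (qrepr x).

Lemma sqrepr_in x : sqrepr x \in Z.
Proof. exact: valP. Qed.
Lemma sqreprK : cancel sqrepr sqclass.
Proof. by move=> x; rewrite /sqclass /sqrepr valKd qreprK. Qed.
Lemma sqclass_eq u v : u \in Z -> v \in Z ->
  (sqclass u == sqclass v) = (u - v \in B).
Proof.
by move=> uZ vZ; rewrite qclass_eq inE raddfB /= !insubdK.
Qed.
Lemma sqclassP a u v : u \in Z -> v \in Z ->
  sqclass (a *: u + v) = a *: sqclass u + sqclass v.
Proof.
move=> uZ vZ; rewrite /sqclass -linearP; congr (qclass _ _).
by apply: val_inj; rewrite linearP /= !insubdK // rpredD // rpredZ.
Qed.

End Subquotient.

Section Subquot_map.
Variables (V W : lmodType R) (Z B : submodule V) (Z' B' : submodule W).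

(* the map induced by f : V -> W when f maps Z to Z' and B to B' *)
Definition sqmap (f : V -> W) (x : subquot Z B) : subquot Z' B' :=
  sqclass Z' B' (f (sqrepr x)).

Variable f : {linear V -> W}.
Hypothesis fZ : forall v, v \in Z -> f v \in Z'.
Hypothesis fB : forall v, v \in Z -> v \in B -> f v \in B'.

Lemma sqmap_class v : v \in Z -> sqmap f (sqclass Z B v) = sqclass Z' B' (f v).
Proof.
move=> vZ; apply/eqP; rewrite sqclass_eq ?fZ ?sqrepr_in // -linearB fB //.
  by rewrite rpredB ?sqrepr_in.
by rewrite -(@sqclass_eq _ Z) ?sqrepr_in // sqreprK.
Qed.

Lemma sqmap_linear : linear (sqmap f).
Proof.
move=> a x y; rewrite -[x]sqreprK -[y]sqreprK.
have [xZ yZ] := (sqrepr_in x, sqrepr_in y).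
rewrite -sqclassP // !sqmap_class ?rpredD ?rpredZ //.
by rewrite linearP sqclassP ?fZ.
Qed.

End Subquot_map.

Arguments sqmap {V W Z B Z' B'} f x.

(* for a finite index type this is the direct sum *)
Section Product.
Variables (I : Type) (V : I -> lmodType R).

Definition dprod := forall i, V i.
HB.instance Definition _ := Choice.on dprod.

Definition dprod_zero : dprod := fun=> 0.
Definition dprod_opp (x : dprod) : dprod := fun i => - x i.
Definition dprod_add (x y : dprod) : dprod := fun i => x i + y i.
Definition dprod_scale a (x : dprod) : dprod := fun i => a *: x i.

Fact dprod_addA : associative dprod_add.
Proof. by move=> x y z; apply: functional_extensionality_dep => i; apply: addrA. Qed.
Fact dprod_addC : commutative dprod_add.
Proof. by move=> x y; apply: functional_extensionality_dep => i; apply: addrC. Qed.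
Fact dprod_add0 : left_id dprod_zero dprod_add.
Proof. by move=> x; apply: functional_extensionality_dep => i; apply: add0r. Qed.
Fact dprod_addN : left_inverse dprod_zero dprod_opp dprod_add.
Proof. by move=> x; apply: functional_extensionality_dep => i; apply: addNr. Qed.
HB.instance Definition _ :=
  GRing.isZmodule.Build dprod dprod_addA dprod_addC dprod_add0 dprod_addN.

Fact dprod_scaleA a b x : dprod_scale a (dprod_scale b x) = dprod_scale (a * b) x.
Proof. by apply: functional_extensionality_dep => i; apply: scalerA. Qed.
Fact dprod_scale1 : left_id 1 dprod_scale.
Proof. by move=> x; apply: functional_extensionality_dep => i; apply: scale1r. Qed.
Fact dprod_scaleDr : right_distributive dprod_scale +%R.
Proof. by move=> a x y; apply: functional_extensionality_dep => i; apply: scalerDr. Qed.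
Fact dprod_scaleDl x : {morph dprod_scale^~ x : a b / a + b}.
Proof. by move=> a b; apply: functional_extensionality_dep => i; apply: scalerDl. Qed.
HB.instance Definition _ := GRing.Zmodule_isLmodule.Build R dprod
  dprod_scaleA dprod_scale1 dprod_scaleDr dprod_scaleDl.

Lemma dprod0E i : (0 : dprod) i = 0.
Proof. by []. Qed.
Lemma dprodPE a (x y : dprod) i : (a *: x + y) i = a *: x i + y i.
Proof. by []. Qed.

End Product.

(* The direct limit of H 0 -> H 1 -> H 2 -> ... , as sequences that are
   eventually compatible with the transition maps, modulo eventually zero ones. *)
Section DirectLimit.
Variables (H : nat -> lmodType R) (phi : forall t, {linear H t -> H t.+1}).

Definition ev_compatible_pred : {pred dprod H} :=
  [pred F | `[< exists N, forall t, (N <= t)%N -> F t.+1 = phi t (F t) >]].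
Definition ev_zero_pred : {pred dprod H} :=
  [pred F | `[< exists N, forall t, (N <= t)%N -> F t = 0 >]].

Fact ev_compatible_submod : submod_closed ev_compatible_pred.
Proof.
split=> [|a F G /asboolP[M FM] /asboolP[N GN]]; apply/asboolP.
  by exists 0%N => t _; rewrite !dprod0E linear0.
exists (maxn M N) => t; rewrite geq_max => /andP[/FM Ft /GN Gt].
by rewrite !dprodPE linearP Ft Gt.
Qed.
Definition ev_compatible := Submodule ev_compatible_submod.

Fact ev_zero_submod : submod_closed ev_zero_pred.
Proof.
split=> [|a F G /asboolP[M FM] /asboolP[N GN]]; apply/asboolP.
  by exists 0%N.
exists (maxn M N) => t; rewrite geq_max => /andP[/FM Ft /GN Gt].
by rewrite dprodPE Ft Gt scaler0 addr0.
Qed.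
Definition ev_zero := Submodule ev_zero_submod.

Definition dirlim := subquot ev_compatible ev_zero.
HB.instance Definition _ := GRing.Lmodule.on dirlim.

(* 0, ..., 0, h, phi h, phi (phi h), ... with h in position t *)
Fixpoint dirlim_seq t (h : H t) (s : nat) : H s :=
  match s with
  | 0 => dfwith (fun u => 0 : H u) h 0
  | s'.+1 => dfwith (fun u => 0 : H u) h s'.+1 + phi s' (dirlim_seq h s')
  end.

Definition dirlim_in t (h : H t) : dirlim := sqclass ev_compatible ev_zero (dirlim_seq h).

Lemma dirlim_seq_compatible t (h : H t) : (dirlim_seq h : dprod H) \in ev_compatible.
Proof.
apply/asboolP; exists t => s ts.
by rewrite /= dfwith_out ?add0r // neq_ltn ltnS ts.
Qed.

End DirectLimit.

Section DirectLimitMap.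
Variables (H : nat -> lmodType R) (phi : forall t, {linear H t -> H t.+1}).
Variable f : forall t, {linear H t -> H t}.
Hypothesis f_phi : forall t h, f t.+1 (phi t h) = phi t (f t h).

Definition dprod_map (F : dprod H) : dprod H := fun t => f t (F t).
Fact dprod_map_linear : linear dprod_map.
Proof. by move=> a F G; apply: functional_extensionality_dep => t; apply: linearP. Qed.
HB.instance Definition _ :=
  GRing.isLinear.Build R (dprod H) (dprod H) _ dprod_map dprod_map_linear.

Definition dirlim_map : dirlim phi -> dirlim phi := sqmap dprod_map.

Lemma dprod_map_compatible F :
  F \in ev_compatible phi -> dprod_map F \in ev_compatible phi.
Proof.
move=> /asboolP[N FN]; apply/asboolP; exists N => t /FN Ft.
by rewrite /dprod_map Ft f_phi.
Qed.
Lemma dprod_map_zero (F : dprod H) : F \in @ev_zero H -> dprod_map F \in @ev_zero H.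
Proof.
move=> /asboolP[N FN]; apply/asboolP; exists N => t /FN Ft.
by rewrite /dprod_map Ft linear0.
Qed.
Lemma dirlim_map_linear : linear dirlim_map.
Proof.
apply: sqmap_linear; first exact: dprod_map_compatible.
by move=> F _; apply: dprod_map_zero.
Qed.

End DirectLimitMap.

(* A cochain complex is given by one module V, a differential d : V -> V and
   the submodules C i of homogeneous elements of degree i. *)
Section Cohomology.
Variables (V : lmodType R) (d : {linear V -> V}) (C : int -> submodule V) (i : int).

Definition cocycles_pred : {pred V} := [pred c | (c \in C i) && (d c == 0)].
Definition coboundaries_pred : {pred V} :=
  [pred c | `[< exists2 b, b \in C (i - 1) & c = d b >]].

Fact cocycles_submod : submod_closed cocycles_pred.
Proof.
split=> [|a u v]; rewrite !inE ?rpred0 ?linear0 ?eqxx //.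
move=> /andP[uC /eqP du] /andP[vC /eqP dv].
by rewrite rpredD ?rpredZ //= linearP du dv scaler0 addr0.
Qed.
Definition cocycles := Submodule cocycles_submod.

Fact coboundaries_submod : submod_closed coboundaries_pred.
Proof.
split=> [|a u v /asboolP[b bC ->] /asboolP[c cC ->]]; apply/asboolP.
  by exists 0; rewrite ?rpred0 ?linear0.
by exists (a *: b + c); rewrite ?linearP // rpredD ?rpredZ.
Qed.
Definition coboundaries := Submodule coboundaries_submod.

Definition cohomology := subquot cocycles coboundaries.
HB.instance Definition _ := GRing.Lmodule.on cohomology.

Definition cohclass (c : V) : cohomology := sqclass cocycles coboundaries c.

End Cohomology.

Section CohomologyMap.
Variables (V : lmodType R) (d : {linear V -> V}) (C : int -> submodule V).
Variables (W : lmodType R) (d' : {linear W -> W}) (C' : int -> submodule W).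
Variable i : int.

Definition cohmap (f : V -> W) : cohomology d C i -> cohomology d' C' i := sqmap f.

Variable f : {linear V -> W}.
Hypothesis fC : forall l c, c \in C l -> f c \in C' l.
Hypothesis fd : forall c, f (d c) = d' (f c).

Lemma cohmap_cocycle c : c \in cocycles d C i -> f c \in cocycles d' C' i.
Proof. by rewrite !inE -fd => /andP[/fC-> /eqP->]; rewrite linear0 eqxx. Qed.
Lemma cohmap_coboundary c : c \in coboundaries d C i -> f c \in coboundaries d' C' i.
Proof.
move=> /asboolP[b bC ->]; apply/asboolP; exists (f b); first exact: fC.
exact: fd.
Qed.
Lemma cohmap_class c : c \in cocycles d C i ->
  cohmap f (cohclass d C i c) = cohclass d' C' i (f c).
Proof.
move=> cZ; apply: sqmap_class => // v; first exact: cohmap_cocycle.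
by move=> _; apply: cohmap_coboundary.
Qed.
Lemma cohmap_linear : linear (cohmap f).
Proof.
apply: sqmap_linear => v; first exact: cohmap_cocycle.
by move=> _; apply: cohmap_coboundary.
Qed.

End CohomologyMap.

End Modules.

Arguments sqmap {R V W Z B Z' B'} f x.
Arguments cohmap {R V d C W d' C' i} f x.

Section Orientation.
Variable n : nat.
Implicit Types (s : 'I_n -> 'I_n) (sigma : {set 'I_n}) (v : 'I_n).

(* position of v in sigma = {v_0 < v_1 < ...} *)
Definition pos v sigma : nat := #|[set u in sigma | (u < v)%N]|.

Definition inversions s sigma : nat :=
  #|[set p : 'I_n * 'I_n | [&& p.1 \in sigma, p.2 \in sigma, (p.1 < p.2)%N
                             & (s p.2 < s p.1)%N]]|.

Lemma inversionsE s sigma : inversions s sigma =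
  (\sum_(a in sigma) \sum_(b in sigma) ((a < b)%N && (s b < s a)%N))%N.
Proof.
rewrite /inversions -sum1_card pair_big /= big_mkcond [RHS]big_mkcond /=.
apply: eq_bigr => -[a b] _ /=; rewrite inE /=.
by case: (a \in sigma); case: (b \in sigma) => //=; case: ifP.
Qed.

Lemma posE v sigma : pos v sigma = (\sum_(u in sigma) (u < v)%N)%N.
Proof.
rewrite /pos -sum1_card big_mkcond [RHS]big_mkcond /=.
by apply: eq_bigr => u _; rewrite inE; case: (u \in sigma) => //=; case: ifP.
Qed.

Lemma inversions_pos s sigma v : injective s -> v \in sigma ->
  odd (inversions s sigma + pos (s v) (s @: sigma)) =
  odd (pos v sigma + inversions s (sigma :\ v)).
Proof.
move=> s_inj v_s; rewrite !posE !inversionsE big_imset /=; last exact: in2W.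
have inD (F : 'I_n -> nat) : (\sum_(a in sigma :\ v) F a =
    \sum_(a in sigma | a != v) F a)%N.
  by apply: eq_bigl => a; rewrite !inE andbC.
have inDv (F : 'I_n -> nat) : F v = 0%N ->
    (\sum_(a in sigma) F a = \sum_(a in sigma :\ v) F a)%N.
  by move=> Fv; rewrite (bigD1 v) //= Fv add0n inD.
have -> : (\sum_(a in sigma) \sum_(b in sigma) ((a < b) && (s b < s a)) =
    \sum_(b in sigma :\ v) ((v < b) && (s b < s v)) +
    (\sum_(a in sigma :\ v) ((a < v) && (s v < s a)) +
     \sum_(a in sigma :\ v) \sum_(b in sigma :\ v) ((a < b) && (s b < s a))))%N.
  rewrite (bigD1 v) //=; congr addn; first by rewrite inDv ?ltnn.
  rewrite -inD -big_split /=.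
  by apply: eq_bigr => a _; rewrite (bigD1 v) //= -inD.
rewrite (inDv (fun u => _ (s u < s v)%N)) ?ltnn // (inDv (fun u => _ (u < v)%N)) ?ltnn //.
rewrite addnA addnAC oddD [RHS]oddD; congr addb; rewrite -!big_split /=.
rewrite big_seq_cond [in RHS]big_seq_cond.
apply: (big_ind2 (fun x y => odd x = odd y)) => //.
  by move=> x1 x2 y1 y2; rewrite !oddD => -> ->.
move=> a /andP[_]; rewrite !inE => /andP[nav _].
have nv : (a != v :> nat) by [].
have ns : (s a != s v :> nat) by rewrite (inj_eq val_inj) (inj_eq s_inj).
by case: (ltngtP a v) nv => //; case: (ltngtP (s a) (s v)) ns.
Qed.

End Orientation.

(* The empty family is allowed, and points of 'I_n need not be vertices. *)
Record simplicial_complex n := SimplicialComplex {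
  faces :> {set {set 'I_n}};
  face_subset : forall sigma tau : {set 'I_n},
    tau \subset sigma -> sigma \in faces -> tau \in faces }.

Definition supp_set n (U : 'X_{1..n}) : {set 'I_n} := [set v | 0 < U v]%N.

Definition cost n (Delta : simplicial_complex n) (sigma : {set 'I_n}) :
  {set {set 'I_n}} := [set tau in faces Delta | ~~ (sigma \subset tau)].

Record multidegree n (Delta : simplicial_complex n) (j : nat) := Multidegree {
  mnm_of :> 'X_{1..n};
  mnm_ofP : (mdeg mnm_of == j) && (supp_set mnm_of \in faces Delta) }.

Section MultidegreeFinite.
Variables (n : nat) (Delta : simplicial_complex n) (j : nat).
Local Notation T := (multidegree Delta j).

HB.instance Definition _ := [isSub for @mnm_of n Delta j].
HB.instance Definition _ := [Countable of T by <:].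

Definition bmnm_of (U : T) : 'X_{1..n < j.+1} := insubd bm0 (val U).
Definition of_bmnm (m : 'X_{1..n < j.+1}) : option T := insub (val m).
Fact bmnm_ofK : pcancel bmnm_of of_bmnm.
Proof.
move=> U; rewrite /of_bmnm /bmnm_of insubdK ?valK //.
by case/andP: (valP U) => /eqP UE _; rewrite unfold_in UE.
Qed.
HB.instance Definition _ : isFinite T := PCanIsFinite bmnm_ofK.

End MultidegreeFinite.

Section Simplicial.
Variables (k : fieldType) (n : nat) (Delta : simplicial_complex n).
Local Notation cochain := {ffun {set 'I_n} -> k^o}.

(* c sigma is the value of the cochain c on sigma, oriented by the order of 'I_n *)
Definition coboundary (c : cochain) : cochain :=
  [ffun sigma => if sigma \in faces Delta then
     \sum_(v in sigma) (-1) ^+ pos v sigma *: c (sigma :\ v) else 0].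

Fact coboundary_linear : linear coboundary.
Proof.
move=> a b c; apply/ffunP => sigma; rewrite !ffunE.
case: ifP => _; last by rewrite scaler0 addr0.
rewrite scaler_sumr -big_split /=; apply: eq_bigr => v _.
by rewrite !ffunE scalerDr !scalerA mulrC.
Qed.
HB.instance Definition _ :=
  GRing.isLinear.Build k cochain cochain _ coboundary coboundary_linear.

(* C^i(Delta, Gamma); the empty face has degree -1 *)
Definition rel_cochains_pred (Gamma : {set {set 'I_n}}) (i : int) : {pred cochain} :=
  [pred c : cochain | [forall sigma : {set 'I_n},
    [&& sigma \in faces Delta, sigma \notin Gamma & #|sigma|%:Z == i + 1]
    || (c sigma == 0)]].

Fact rel_cochains_submod Gamma i : submod_closed (rel_cochains_pred Gamma i).
Proof.
split=> [|a b c /forallP bC /forallP cC]; apply/forallP => sigma.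
  by rewrite ffunE eqxx orbT.
case/orP: (bC sigma) => [-> //|/eqP b0]; case/orP: (cC sigma) => [-> //|/eqP c0].
by rewrite !ffunE b0 c0 scaler0 addr0 eqxx orbT.
Qed.
Definition rel_cochains Gamma i := Submodule (rel_cochains_submod Gamma i).

Definition rel_cohomology Gamma i := cohomology coboundary (rel_cochains Gamma) i.
HB.instance Definition _ Gamma i := GRing.Lmodule.on (rel_cohomology Gamma i).

(* \bigoplus_(U in T(Delta)_j) H^i(Delta, cost s(U)) *)
Definition sum_cohomology (i : int) (j : nat) :=
  dprod (fun U : multidegree Delta j => rel_cohomology (cost Delta (supp_set U)) i).
HB.instance Definition _ i j := GRing.Lmodule.on (sum_cohomology i j).

End Simplicial.

Section SimplicialAction.
Variables (gT : finGroupType) (n : nat).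

Definition act_face (to : {action gT &-> 'I_n}) (g : gT) (sigma : {set 'I_n}) :=
  [set to v g | v in sigma].

(* MathComp actions are right actions; for abelian groups this is immaterial. *)
Record simplicial_action (Delta : simplicial_complex n) := SimplicialAction {
  vertex_act :> {action gT &-> 'I_n};
  act_face_in : forall g sigma,
    sigma \in faces Delta -> act_face vertex_act g sigma \in faces Delta }.

Definition free_action Delta (to : simplicial_action Delta) :=
  forall g sigma, sigma \in faces Delta -> sigma != set0 -> g != 1%g ->
    act_face to g sigma != sigma.

(* g [v_0, ..., v_t] = osign to g sigma * [g sigma] for sigma = {v_0 < ... < v_t} *)
Definition osign (k : fieldType) (to : {action gT &-> 'I_n}) g sigma : k :=
  (-1) ^+ inversions (fun v => to v g) sigma.

Section Faces.
Variable to : {action gT &-> 'I_n}.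
Implicit Types (g : gT) (sigma : {set 'I_n}).

Lemma to_inj g : injective (fun v => to v g).
Proof. exact: act_inj. Qed.
Lemma toK g v : to (to v g) g^-1%g = v.
Proof. exact: actK. Qed.
Lemma toVK g v : to (to v g^-1%g) g = v.
Proof. exact: actKV. Qed.
Lemma act_faceE g sigma v : (v \in act_face to g sigma) = (to v g^-1%g \in sigma).
Proof.
apply/imsetP/idP => [[u us ->]|vs]; first by rewrite toK.
by exists (to v g^-1%g); rewrite ?toVK.
Qed.
Lemma act_faceK g : cancel (act_face to g) (act_face to g^-1%g).
Proof. by move=> sigma; apply/setP => v; rewrite !act_faceE invgK toK. Qed.
Lemma act_faceKV g : cancel (act_face to g^-1%g) (act_face to g).
Proof. by move=> sigma; apply/setP => v; rewrite !act_faceE invgK toVK. Qed.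
Lemma card_act_face g sigma : #|act_face to g sigma| = #|sigma|.
Proof. exact: card_imset (@to_inj g). Qed.
Lemma act_faceD1 g sigma v :
  act_face to g (sigma :\ v) = act_face to g sigma :\ to v g.
Proof.
apply/setP => u; rewrite !(act_faceE, inE); congr (~~ _ && _).
by rewrite -(inj_eq (@to_inj g)) toVK.
Qed.
Lemma osign_pos (k : fieldType) g sigma v : v \in sigma ->
  osign k to g sigma * (-1) ^+ pos (to v g) (act_face to g sigma) =
  (-1) ^+ pos v sigma * osign k to g (sigma :\ v).
Proof.
move=> vs; rewrite /osign -!exprD -[LHS]signr_odd -[RHS]signr_odd.
by rewrite (inversions_pos (@to_inj g) vs).
Qed.

End Faces.

Variables (Delta : simplicial_complex n) (to : simplicial_action Delta).

Lemma in_act_face g sigma : (act_face to g sigma \in faces Delta) = (sigma \in faces Delta).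
Proof.
apply/idP/idP => [|/act_face_in->//] gs.
by rewrite -(act_faceK to g sigma) act_face_in.
Qed.

(* (g U)_(g v) = U_v *)
Definition act_mnm (g : gT) (U : 'X_{1..n}) : 'X_{1..n} :=
  [multinom U (to v g^-1%g) | v < n].

Lemma supp_act_mnm g U : supp_set (act_mnm g U) = act_face to g (supp_set U).
Proof. by apply/setP => v; rewrite act_faceE !inE mnmE. Qed.

Fact act_mnm_in j g (U : multidegree Delta j) :
  (mdeg (act_mnm g U) == j) && (supp_set (act_mnm g U) \in faces Delta).
Proof.
case: U => U /= /andP[/eqP <- US]; rewrite supp_act_mnm act_face_in // andbT.
rewrite !mdegE (reindex_inj (@to_inj to g)) /=.
by apply/eqP/eq_bigr => v _; rewrite mnmE toK.
Qed.
Definition act_multidegree j g (U : multidegree Delta j) : multidegree Delta j :=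
  Multidegree (act_mnm_in g U).

Variable k : fieldType.
Local Notation cochain := {ffun {set 'I_n} -> k^o}.

(* (g c)(tau) = c(g tau) on oriented simplices *)
Definition pullback (g : gT) (c : cochain) : cochain :=
  [ffun sigma => osign k to g sigma *: c (act_face to g sigma)].

Fact pullback_linear g : linear (pullback g).
Proof. by move=> a b c; apply/ffunP => s; rewrite !ffunE scalerDr !scalerA mulrC. Qed.
HB.instance Definition _ g :=
  GRing.isLinear.Build k cochain cochain _ (pullback g) (pullback_linear g).

Lemma pullback_coboundary g c :
  pullback g (coboundary Delta c) = coboundary Delta (pullback g c).
Proof.
apply/ffunP => s; rewrite !ffunE in_act_face.
case: ifP => _; last by rewrite scaler0.
rewrite [X in _ *: X]big_imset /=; last by move=> u v _ _; apply: to_inj.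
rewrite scaler_sumr; apply: eq_bigr => v vs.
by rewrite ffunE !scalerA osign_pos // act_faceD1.
Qed.

Lemma pullback_cochains g sigma i c :
  c \in rel_cochains k Delta (cost Delta (act_face to g sigma)) i ->
  pullback g c \in rel_cochains k Delta (cost Delta sigma) i.
Proof.
move=> /forallP cC; apply/forallP => tau; rewrite ffunE.
case/orP: (cC (act_face to g tau)) => [|/eqP->]; last by rewrite scaler0 eqxx orbT.
rewrite card_act_face !inE in_act_face => /and3P[-> + ->].
rewrite !andbT /= !negbK => sub; apply/orP; left.
by apply/subsetP => v vs; have := subsetP sub (to v g); rewrite !act_faceE toK => ->.
Qed.

(* maps the summand of index U to the summand of index g^-1 U *)
Definition sum_act (i : int) (j : nat) (g : gT) (h : sum_cohomology k Delta i j) :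
  sum_cohomology k Delta i j :=
  fun U => cohmap (pullback g) (h (act_multidegree g U)).

Lemma pullback_cochains_mnm g (U : 'X_{1..n}) i c :
  c \in rel_cochains k Delta (cost Delta (supp_set (act_mnm g U))) i ->
  pullback g c \in rel_cochains k Delta (cost Delta (supp_set U)) i.
Proof. by rewrite supp_act_mnm; apply: pullback_cochains. Qed.

Fact sum_act_linear i j g : linear (@sum_act i j g).
Proof.
move=> a x y; apply: functional_extensionality_dep => U.
apply: cohmap_linear => [l c|c]; first exact: pullback_cochains_mnm.
exact: pullback_coboundary.
Qed.
HB.instance Definition _ i j g := GRing.isLinear.Build k
  (sum_cohomology k Delta i j) (sum_cohomology k Delta i j) _
  (@sum_act i j g) (@sum_act_linear i j g).

End SimplicialAction.

Section StanleyReisner.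
Variables (k : fieldType) (n : nat) (Delta : simplicial_complex n).
Local Notation A := {mpoly k[n]}.

Definition SR_ideal_pred : {pred A} :=
  [pred p : A | `[< exists a : {set 'I_n} -> A,
     p = \sum_(sigma | sigma \notin faces Delta) a sigma * \prod_(v in sigma) 'X_v >]].

Fact SR_ideal_submod : submod_closed SR_ideal_pred.
Proof.
split=> [|c p q /asboolP[a ->] /asboolP[b ->]]; apply/asboolP.
  by exists (fun=> 0); rewrite big1 // => sigma _; rewrite mul0r.
exists (fun sigma => c *: a sigma + b sigma).
rewrite scaler_sumr -big_split /=; apply: eq_bigr => sigma _.
by rewrite mulrDl scalerAl.
Qed.
Definition SR_ideal := Submodule SR_ideal_submod.

Lemma SR_idealM p q : q \in SR_ideal -> p * q \in SR_ideal.
Proof.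
move=> /asboolP[a ->]; apply/asboolP; exists (fun sigma => p * a sigma).
by rewrite mulr_sumr; apply: eq_bigr => sigma _; rewrite mulrA.
Qed.

(* pzRingType, since k[Delta] is zero when Delta has no face *)
Definition SR := quotmod SR_ideal.
HB.instance Definition _ := GRing.Lmodule.on SR.

Definition SRclass (p : A) : SR := qclass SR_ideal p.
Fact SRclass_linear : linear SRclass.
Proof. exact: qclass_linear. Qed.
HB.instance Definition _ := GRing.isLinear.Build k A SR _ SRclass SRclass_linear.

Definition SRrepr (x : SR) : A := qrepr x.
Lemma SRreprK : cancel SRrepr SRclass.
Proof. exact: qreprK. Qed.

Definition SR_mul (x y : SR) : SR := SRclass (SRrepr x * SRrepr y).

Lemma SRclassM p q : SRclass (p * q) = SR_mul (SRclass p) (SRclass q).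
Proof.
have classMr r s t : SRclass s = SRclass t -> SRclass (r * s) = SRclass (r * t).
  move=> /eqP; rewrite qclass_eq => st.
  by apply/eqP; rewrite qclass_eq -mulrBr SR_idealM.
have reprE r : SRclass (SRrepr (SRclass r)) = SRclass r by apply: SRreprK.
rewrite /SR_mul (classMr _ _ _ (reprE q)) [SRrepr _ * q]mulrC.
by rewrite (classMr _ _ _ (reprE p)) mulrC.
Qed.

Fact SR_mulA : associative SR_mul.
Proof.
move=> x y z; rewrite -[x]SRreprK -[y]SRreprK -[z]SRreprK.
by rewrite -!SRclassM mulrA.
Qed.
Fact SR_mulC : commutative SR_mul.
Proof. by move=> x y; rewrite /SR_mul mulrC. Qed.
Fact SR_mul1 : left_id (SRclass 1) SR_mul.
Proof. by move=> x; rewrite -[x]SRreprK -SRclassM mul1r. Qed.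
Fact SR_mulDl : left_distributive SR_mul +%R.
Proof.
move=> x y z; rewrite -[x]SRreprK -[y]SRreprK -[z]SRreprK.
by rewrite -[X in SR_mul X _](linearD SRclass) -!SRclassM mulrDl linearD.
Qed.
HB.instance Definition _ :=
  GRing.Zmodule_isComPzRing.Build SR SR_mulA SR_mulC SR_mul1 SR_mulDl.

Fact SRclass_monoid_morphism : monoid_morphism SRclass.
Proof. by split=> // p q; apply: SRclassM. Qed.
HB.instance Definition _ :=
  GRing.isMonoidMorphism.Build A SR SRclass SRclass_monoid_morphism.

Lemma SR_scalerAr (a : k) (x y : SR) : a *: (x * y) = x * (a *: y).
Proof.
have classZ p : a *: SRclass p = SRclass (a *: p) by rewrite linearZ.
rewrite -[x]SRreprK -[y]SRreprK classZ -!rmorphM classZ.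
by rewrite scalerAr.
Qed.

Definition SR_homog_pred (d : int) : {pred SR} :=
  [pred x : SR | `[< match d with
     | Posz e => exists2 p : A, p \is e.-homog & x = SRclass p
     | Negz _ => x = 0
     end >]].
Fact SR_homog_submod d : submod_closed (SR_homog_pred d).
Proof.
case: d => e; split=> [|a x y].
- by apply/asboolP; exists 0; rewrite ?rpred0 ?linear0.
- move=> /asboolP[p pe ->] /asboolP[q qe ->]; apply/asboolP.
  by exists (a *: p + q); rewrite ?linearP // rpredD ?rpredZ.
- exact/asboolP.
- by move=> /asboolP-> /asboolP->; apply/asboolP; rewrite scaler0 addr0.
Qed.
Definition SR_homog d := Submodule (SR_homog_submod d).

Lemma SR_homogM p (e : nat) d x : p \is e.-homog ->
  x \in SR_homog d -> SRclass p * x \in SR_homog (e%:Z + d).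
Proof.
case: d => d pe /asboolP => [[q qd ->]|->]; last by rewrite mulr0 rpred0.
by apply/asboolP; exists (p * q); [apply: dhomogM | rewrite rmorphM].
Qed.

Definition SRvar (v : 'I_n) : SR := SRclass 'X_v.

(* Let K be the Koszul complex of A on x_1^t, ..., x_n^t. An element f of
   Hom_A(K, k[Delta]) is given by its values f rho on the basis elements
   x_rho (rho = {v_0 < v_1 < ...}) of K. *)
Local Notation koszul_cochain := {ffun {set 'I_n} -> SR}.

Definition koszul_diff (t : nat) (f : koszul_cochain) : koszul_cochain :=
  [ffun rho : {set 'I_n} => \sum_(v in rho)
     (-1 : k) ^+ pos v rho *: (SRvar v ^+ t * f (rho :\ v))].

Fact koszul_diff_linear t : linear (koszul_diff t).
Proof.
move=> a f g; apply/ffunP => rho; rewrite !ffunE.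
rewrite scaler_sumr -big_split /=; apply: eq_bigr => v _.
by rewrite !ffunE mulrDr scalerDr -SR_scalerAr !scalerA [a * _]mulrC.
Qed.
HB.instance Definition _ t := GRing.isLinear.Build k
  koszul_cochain koszul_cochain _ (koszul_diff t) (@koszul_diff_linear t).

(* Hom_A(K_i, k[Delta])_{-j}, where x_rho has degree t |rho| *)
Definition koszul_cochains_pred (t j : nat) (i : int) : {pred koszul_cochain} :=
  [pred f : koszul_cochain | [forall rho : {set 'I_n},
     if #|rho|%:Z == i then f rho \in SR_homog ((t * #|rho|)%:Z - j%:Z)
     else f rho == 0]].
Fact koszul_cochains_submod t j i : submod_closed (koszul_cochains_pred t j i).
Proof.
split=> [|a f g /forallP fC /forallP gC]; apply/forallP => rho.
  by rewrite ffunE; case: ifP; rewrite ?rpred0.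
move: (fC rho) (gC rho); rewrite !ffunE; case: ifP => _.
  by move=> fr gr; rewrite rpredD ?rpredZ.
by move=> /eqP-> /eqP->; rewrite scaler0 addr0.
Qed.
Definition koszul_cochains t j i := Submodule (koszul_cochains_submod t j i).

(* Ext^i_A(A / (x_1^t, ..., x_n^t), k[Delta])_{-j}: K is a free resolution of
   A / (x_1^t, ..., x_n^t) *)
Definition ext (i : int) (j t : nat) := cohomology (koszul_diff t) (koszul_cochains t j) i.
HB.instance Definition _ i j t := GRing.Lmodule.on (ext i j t).

(* induced by the map of Koszul complexes that lifts the projection
   A / (x_1^(t+1), ..., x_n^(t+1)) -> A / (x_1^t, ..., x_n^t) and sends
   x_rho to (\prod_(v in rho) x_v) x_rho *)
Definition koszul_trans (f : koszul_cochain) : koszul_cochain :=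
  [ffun rho : {set 'I_n} => (\prod_(v in rho) SRvar v) * f rho].
Fact koszul_trans_linear : linear koszul_trans.
Proof.
by move=> a f g; apply/ffunP => rho; rewrite !ffunE mulrDr SR_scalerAr.
Qed.
HB.instance Definition _ := GRing.isLinear.Build k
  koszul_cochain koszul_cochain _ koszul_trans koszul_trans_linear.

Lemma koszul_trans_diff t f :
  koszul_trans (koszul_diff t f) = koszul_diff t.+1 (koszul_trans f).
Proof.
apply/ffunP => rho; rewrite !ffunE mulr_sumr; apply: eq_bigr => v vr.
rewrite -SR_scalerAr ffunE (big_setD1 v) //= exprSr; congr (_ *: _).
by rewrite mulrACA [SRvar v * _]mulrC.
Qed.

Lemma koszul_trans_cochains t j i f :
  f \in koszul_cochains t j i -> koszul_trans f \in koszul_cochains t.+1 j i.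
Proof.
move=> /forallP fC; apply/forallP => rho; have := fC rho; rewrite ffunE.
case: ifP => _ => [fr|/eqP->]; last by rewrite mulr0.
rewrite -[\prod_(v in rho) _](rmorph_prod SRclass) mulSn PoszD -addrA.
apply: SR_homogM => //; rewrite -sum1_card.
apply: (big_rec2 (fun e p => p \is e.-homog)) => [|v e p _ pe].
  exact: dhomog1.
rewrite addnC mulrC; apply: dhomogM => //; rewrite dhomogX.
by apply/eqP; apply: mdeg1.
Qed.

Definition ext_trans i j t : ext i j t -> ext i j t.+1 := cohmap koszul_trans.
Fact ext_trans_linear i j t : linear (@ext_trans i j t).
Proof.
apply: cohmap_linear => [l c|c]; first exact: koszul_trans_cochains.
exact: koszul_trans_diff.
Qed.
HB.instance Definition _ i j t := GRing.isLinear.Build k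
  (ext i j t) (ext i j t.+1) _ (@ext_trans i j t) (@ext_trans_linear i j t).

(* H^i_m(k[Delta])_{-j} is the direct limit over t of these Ext^i, because the
   ideals (x_1^t, ..., x_n^t) are cofinal with the powers of m *)
Definition local_cohomology (i : int) (j : nat) :=
  dirlim (fun t => @ext_trans i j t : {linear ext i j t -> ext i j t.+1}).
HB.instance Definition _ i j := GRing.Lmodule.on (local_cohomology i j).

End StanleyReisner.

Section LocalCohomologyAction.
Variables (k : fieldType) (gT : finGroupType) (n : nat).
Variables (Delta : simplicial_complex n) (to : simplicial_action gT Delta).
Local Notation A := {mpoly k[n]}.
Local Notation SR := (SR k Delta).
Local Notation koszul_cochain := {ffun {set 'I_n} -> SR}.

Definition poly_act (g : gT) (p : A) : A := p \mPo [tuple 'X_(to v g) | v < n].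
HB.instance Definition _ g := GRing.LRMorphism.copy (poly_act g)
  (comp_mpoly [tuple ('X_(to v g) : A) | v < n]).

Lemma poly_actX g v : poly_act g 'X_v = 'X_(to v g).
Proof. by rewrite /poly_act comp_mpolyXU -tnth_nth tnth_mktuple. Qed.

Lemma poly_act_prodX g (sigma : {set 'I_n}) :
  poly_act g (\prod_(v in sigma) 'X_v) = \prod_(v in act_face to g sigma) 'X_v.
Proof.
rewrite rmorph_prod /= big_imset /=; last by move=> u v _ _; apply: to_inj.
by apply: eq_bigr => v _; rewrite poly_actX.
Qed.

Lemma poly_act_ideal g p : p \in SR_ideal k Delta -> poly_act g p \in SR_ideal k Delta.
Proof.
move=> /asboolP[a ->]; apply/asboolP.
exists (fun sigma => poly_act g (a (act_face to g^-1%g sigma))).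
rewrite raddf_sum /= [RHS](reindex_inj (can_inj (act_faceK to g))) /=.
apply: eq_big => [sigma|sigma _]; first by rewrite in_act_face.
by rewrite rmorphM /= poly_act_prodX act_faceK.
Qed.

Lemma poly_act_homog g e p : p \is e.-homog -> poly_act g p \is e.-homog.
Proof.
move=> /dhomogP pe; rewrite /poly_act comp_mpolyEX big_seq rpred_sum // => m mp.
have <- : mdeg m = e by exact: pe.
rewrite rpredZ // comp_mpolyX mdegE.
apply: (big_rec2 (fun d q => q \is d.-homog)) => [|v d q _ qd]; first exact: dhomog1.
rewrite addnC mulrC dhomogM // tnth_mktuple.
have X1 : ('X_(to v g) : A) \is 1.-homog.
  by rewrite dhomogX; apply/eqP; apply: mdeg1.
by have := dhomogMn (m v) X1; rewrite mul1n.
Qed.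

Definition SR_act (g : gT) (x : SR) : SR := SRclass Delta (poly_act g (SRrepr x)).

Lemma SR_act_class g p : SR_act g (SRclass Delta p) = SRclass Delta (poly_act g p).
Proof.
apply/eqP; rewrite qclass_eq -raddfB poly_act_ideal //.
by rewrite -qclass_eq; apply/eqP; apply: SRreprK.
Qed.

Fact SR_act_linear g : linear (SR_act g).
Proof.
move=> a x y; rewrite -[x]SRreprK -[y]SRreprK.
have classP u v : a *: SRclass Delta u + SRclass Delta v = SRclass Delta (a *: u + v).
  by rewrite linearP.
by rewrite classP !SR_act_class classP; congr SRclass; apply: linearP.
Qed.
HB.instance Definition _ g :=
  GRing.isLinear.Build k SR SR _ (SR_act g) (SR_act_linear g).

Lemma SR_actM g : {morph SR_act g : x y / x * y}.
Proof.
move=> x y; rewrite -[x]SRreprK -[y]SRreprK -rmorphM !SR_act_class.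
by rewrite -rmorphM; congr SRclass; apply: rmorphM.
Qed.

Lemma SR_act1 g : SR_act g 1 = 1.
Proof. by rewrite -(rmorph1 (SRclass Delta)) SR_act_class; congr SRclass; apply: rmorph1. Qed.

HB.instance Definition _ g :=
  GRing.isMonoidMorphism.Build SR SR (SR_act g) (conj (SR_act1 g) (SR_actM g)).

Lemma SR_act_var g v : SR_act g (SRvar k Delta v) = SRvar k Delta (to v g).
Proof. by rewrite SR_act_class poly_actX. Qed.

Lemma SR_act_homog g d x : x \in SR_homog k Delta d -> SR_act g x \in SR_homog k Delta d.
Proof.
case: d => d /asboolP => [[p pd ->]|->]; last by rewrite linear0 rpred0.
by apply/asboolP; exists (poly_act g p); [apply: poly_act_homog | rewrite SR_act_class].
Qed.

(* G acts on K by g (v_0 ^ ... ^ v_t) = g v_0 ^ ... ^ g v_t, semilinearly over A, and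
   on Hom_A(K, k[Delta]) by (g f)(y) = g (f (g^-1 y)) *)
Definition koszul_act (g : gT) (f : koszul_cochain) : koszul_cochain :=
  [ffun rho : {set 'I_n} =>
     osign k to g^-1%g rho *: SR_act g (f (act_face to g^-1%g rho))].

Fact koszul_act_linear g : linear (koszul_act g).
Proof.
move=> a f h; apply/ffunP => rho.
by rewrite !ffunE linearP scalerDr !scalerA mulrC.
Qed.
HB.instance Definition _ g := GRing.isLinear.Build k
  koszul_cochain koszul_cochain _ (koszul_act g) (koszul_act_linear g).

Lemma koszul_act_diff g t f :
  koszul_act g (koszul_diff t f) = koszul_diff t (koszul_act g f).
Proof.
apply/ffunP => rho; rewrite !ffunE.
rewrite [X in SR_act g X]big_imset /=; last by move=> u v _ _; apply: to_inj.
rewrite raddf_sum scaler_sumr; apply: eq_bigr => v vr /=.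
rewrite ffunE linearZ /= rmorphM rmorphXn /= SR_act_var toVK -SR_scalerAr.
by rewrite !scalerA osign_pos // act_faceD1.
Qed.

Lemma koszul_act_trans g (f : koszul_cochain) :
  koszul_act g (koszul_trans f) = koszul_trans (koszul_act g f).
Proof.
apply/ffunP => rho; rewrite !ffunE rmorphM rmorph_prod /= -SR_scalerAr.
rewrite [X in X * _]big_imset /=; last by move=> u v _ _; apply: to_inj.
by under eq_bigr do rewrite SR_act_var toVK.
Qed.

Lemma koszul_act_cochains g t j i f :
  f \in koszul_cochains k Delta t j i -> koszul_act g f \in koszul_cochains k Delta t j i.
Proof.
move=> /forallP fC; apply/forallP => rho; have := fC (act_face to g^-1%g rho).
rewrite card_act_face ffunE; case: ifP => _ => [fr|/eqP->].
  by rewrite rpredZ // SR_act_homog.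
by rewrite linear0 scaler0.
Qed.

Definition ext_act i j g t : ext k Delta i j t -> ext k Delta i j t :=
  cohmap (koszul_act g).
Fact ext_act_linear i j g t : linear (@ext_act i j g t).
Proof.
apply: cohmap_linear => [l c|c]; first exact: koszul_act_cochains.
exact: koszul_act_diff.
Qed.
HB.instance Definition _ i j g t := GRing.isLinear.Build k
  (ext k Delta i j t) (ext k Delta i j t) _ (@ext_act i j g t) (@ext_act_linear i j g t).

Lemma ext_act_trans i j g t (x : ext k Delta i j t) :
  ext_act g (ext_trans x) = ext_trans (ext_act g x).
Proof.
set c := sqrepr x.
have cZ : c \in cocycles (@koszul_diff k n Delta t) (koszul_cochains k Delta t j) i.
  exact: sqrepr_in.
have actZ : ext_act g (cohclass _ _ i (koszul_trans c) : ext k Delta i j t.+1) =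
    cohclass _ _ i (koszul_act g (koszul_trans c)).
  apply: cohmap_class => [l f||].
  - exact: koszul_act_cochains.
  - exact: koszul_act_diff.
  - apply: (cohmap_cocycle _ _ cZ) => [l f|f]; first exact: koszul_trans_cochains.
    exact: koszul_trans_diff.
have transZ : ext_trans (cohclass _ _ i (koszul_act g c) : ext k Delta i j t) =
    cohclass _ _ i (koszul_trans (koszul_act g c)).
  apply: cohmap_class => [l f||].
  - exact: koszul_trans_cochains.
  - exact: koszul_trans_diff.
  - apply: (cohmap_cocycle _ _ cZ) => [l f|f]; first exact: koszul_act_cochains.
    exact: koszul_act_diff.
apply: etrans actZ (etrans _ (esym transZ)).
by congr cohclass; apply: koszul_act_trans.
Qed.

Definition local_cohomology_act (i : int) (j : nat) (g : gT) :
  local_cohomology k Delta i j -> local_cohomology k Delta i j :=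
  dirlim_map (fun t => @ext_act i j g t : {linear _ -> _}).
Fact local_cohomology_act_linear i j g : linear (@local_cohomology_act i j g).
Proof. by apply: dirlim_map_linear => t h; apply: ext_act_trans. Qed.
HB.instance Definition _ i j g := GRing.isLinear.Build k
  (local_cohomology k Delta i j) (local_cohomology k Delta i j) _
  (@local_cohomology_act i j g) (@local_cohomology_act_linear i j g).

End LocalCohomologyAction.

Section HochsterGraebe.
Variables (k : fieldType) (n : nat) (Delta : simplicial_complex n).
Local Notation koszul_cochain := {ffun {set 'I_n} -> SR k Delta}.
Local Notation cochain := {ffun {set 'I_n} -> k^o}.

(* (\prod_(v in sigma) x_v ^ (j + 1)) / x^U; used for s(U) \subset sigma and |U| = j *)
Definition quotient_mnm (j : nat) (U : 'X_{1..n}) (sigma : {set 'I_n}) : 'X_{1..n} :=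
  [multinom ((v \in sigma) * j.+1 - U v)%N | v < n].

Definition hg_hom (j : nat) (U : 'X_{1..n}) (sigma : {set 'I_n}) : koszul_cochain :=
  [ffun rho => if rho == sigma then SRclass Delta 'X_[quotient_mnm j U sigma] else 0].

(* sends the dual class of sigma in the summand U to hg_hom j U sigma *)
Definition hg_cochain (j : nat) (c : multidegree Delta j -> cochain) : koszul_cochain :=
  \sum_(U : multidegree Delta j) \sum_(sigma in faces Delta | supp_set U \subset sigma)
     c U sigma *: hg_hom j U sigma.

(* hg is induced on cohomology by hg_cochain, through
   Ext^i(A / (x_1^(j+1), ..., x_n^(j+1)), k[Delta])_{-j} -> H^i_m(k[Delta])_{-j} *)
Definition is_hochster_graebe (i : int) (j : nat)
    (hg : sum_cohomology k Delta (i - 1) j -> local_cohomology k Delta i j) :=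
  forall c : multidegree Delta j -> cochain,
    (forall U, c U \in cocycles (@coboundary k n Delta)
                         (rel_cochains k Delta (cost Delta (supp_set U))) (i - 1)) ->
    hg (fun U => cohclass _ _ _ (c U)) =
      dirlim_in _ (cohclass _ _ _ (hg_cochain c) : ext k Delta i j j.+1).

End HochsterGraebe.

Section Isotypic.
Variables (k : fieldType) (gT : finGroupType).

Definition irreducible_character (chi : gT -> k) :=
  exists m (rG : mx_representation k [set: gT] m),
    mx_irreducible rG /\ forall g, chi g = \tr (rG g).

Variables (N : lmodType k) (act : gT -> {linear N -> N}) (chi : gT -> k).

Definition isotypic_pred : {pred N} := [pred x | [forall g, act g x == chi g *: x]].
Fact isotypic_submod : submod_closed isotypic_pred.
Proof.
split=> [|a x y /forallP xN /forallP yN]; apply/forallP => g.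
  by rewrite linear0 scaler0.
rewrite linearP (eqP (xN g)) (eqP (yN g)) scalerDr.
by rewrite !scalerA mulrC.
Qed.
Definition isotypic := submod (Submodule isotypic_submod).
HB.instance Definition _ := GRing.Lmodule.on isotypic.

End Isotypic.

(* Main.v *)
(* Grade Hom_A(K, k[Delta]) by Z^n, the monomial x^m at x_rho having degree
   a = m - t rho, where K is the Koszul complex on x_1^t, ..., x_n^t with t > j. If
   some a_v is positive, multiplication by x_v^t is a bijection between the monomials
   of degree a at rho and at rho + v, so the part of degree a is contractible. If
   a = - U <= 0 and |U| = j, then U_v < t for all v, hence the monomial has support
   rho, and the part of degree a is the complex C(Delta, cost s(U)), placed in
   Hom_A(K, k[Delta]) by the Hochster-Graebe map. The transition maps in t preserve a,
   so they are isomorphisms on cohomology for t > j. Finally the isomorphism carries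
   the action of g, a pullback on one side, to that of g^-1 on the other, and chi is
   multiplicative because k contains the roots of unity of order |G|. *)
Require Import Defs.
From HB Require Import structures.
From mathcomp Require Import all_boot all_order all_algebra all_fingroup all_character.
From mathcomp Require Import cyclic separable cyclotomic.
From mathcomp Require Import boolp reals complex mpoly.

Set Implicit Arguments.
Unset Strict Implicit.
Unset Printing Implicit Defensive.

Import Order.TTheory GRing.Theory Num.Theory.

Local Open Scope ring_scope.

(** * Monomial coefficients in the Stanley-Reisner ring *)

Section StanleyReisnerCoefficients.
Variables (k : fieldType) (n : nat) (Delta : simplicial_complex n).
Local Notation SR := (SR k Delta).
Local Notation A := {mpoly k[n]}.
Implicit Types (m : 'X_{1..n}) (p : A) (x y : SR) (v : 'I_n).

Definition set_mnm (t : nat) (sigma : {set 'I_n}) : 'X_{1..n} :=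
  [multinom ((v \in sigma) * t)%N | v < n].

Lemma prod_var_mnm (sigma : {set 'I_n}) :
  \prod_(v in sigma) 'X_v = 'X_[set_mnm 1 sigma] :> A.
Proof.
rewrite mpolyXE_id big_mkcond; apply: eq_bigr => v _.
by rewrite mnmE muln1; case: (v \in sigma).
Qed.

Lemma mcoeff_sum_msupp p m : \sum_(m' <- msupp p) p@_m' * (m' == m)%:R = p@_m.
Proof.
rewrite [in RHS](mpolyE p) raddf_sum /=.
by apply: eq_bigr => m' _; rewrite mcoeffZ mcoeffX.
Qed.

Lemma mcoeffMXE p m m' :
  (p * 'X_[m])@_m' = if (m <= m')%MM then p@_(m' - m) else 0.
Proof.
case: ifP => [mm'|/negP mm']; first by rewrite -{1}(submK mm') addmC mcoeffMX.
rewrite {1}[p]mpolyE mulr_suml raddf_sum big1 // => u _ /=.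
rewrite -scalerAl -mpolyXD mcoeffZ mcoeffX.
case: eqP => [um|]; last by rewrite mulr0.
by case: mm'; rewrite -um lem_addl.
Qed.

Lemma supp_set_le m m' : (m <= m')%MM -> supp_set m \subset supp_set m'.
Proof.
move=> /mnm_lepP le; apply/subsetP => v; rewrite !inE => mv.
exact: leq_trans mv (le v).
Qed.

(** The ideal is a monomial ideal. A multiple of the generator of a non-face has only monomials
    whose support contains it, and a monomial with non-face support is a multiple of the generator
    of that support. *)
Lemma mem_SR_ideal p :
  p \in SR_ideal k Delta <-> forall m, supp_set m \in faces Delta -> p@_m = 0.
Proof.
split=> [/asboolP[a ->] m mD|p0].
  rewrite raddf_sum big1 // => sigma sD /=.
  rewrite prod_var_mnm mcoeffMXE; case: ifP => // /supp_set_le le.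
  case/negP: sD; apply: (face_subset _ mD); apply: subset_trans le.
  by apply/subsetP => v vs; rewrite inE mnmE vs.
rewrite [p]mpolyE; apply: rpred_sum => m _.
have [/p0 ->|mD] := boolP (supp_set m \in faces Delta); first by rewrite scale0r rpred0.
rewrite rpredZ //.
have <- : (m - set_mnm 1 (supp_set m) + set_mnm 1 (supp_set m))%MM = m.
  apply: submK; apply/mnm_lepP => v; rewrite mnmE muln1 inE.
  by case: (m v).
rewrite mpolyXD -prod_var_mnm SR_idealM //; apply/asboolP.
exists (fun sigma => (sigma == supp_set m)%:R).
rewrite (bigD1 (supp_set m)) //= eqxx mul1r [X in _ + X]big1 ?addr0 // => sigma.
by move=> /andP[_ /negbTE->]; rewrite mul0r.
Qed.

(* Independent of the representative of x: the ideal of Delta is spanned by the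
   monomials whose support is not a face. *)
Definition SRcoef m x : k^o := if supp_set m \in faces Delta then (SRrepr x)@_m else 0.

Lemma SRcoef_class m p :
  SRcoef m (SRclass Delta p) = if supp_set m \in faces Delta then p@_m else 0.
Proof.
rewrite /SRcoef; case: ifP => // mD; apply/eqP; rewrite -subr_eq0 -raddfB.
apply/eqP; move: m mD; apply/mem_SR_ideal.
by rewrite -qclass_eq; apply/eqP; apply: SRreprK.
Qed.

Fact SRcoef_linear m : linear (SRcoef m).
Proof.
move=> a x y; rewrite -[x]SRreprK -[y]SRreprK.
rewrite -[_ + _](linearP (SRclass Delta)) !SRcoef_class.
case: ifP => _; last by rewrite scaler0 addr0.
exact: linearP.
Qed.
HB.instance Definition _ m := GRing.isLinear.Build k SR k^o _ (SRcoef m) (SRcoef_linear m).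

Lemma SRcoefP x y : (forall m, SRcoef m x = SRcoef m y) -> x = y.
Proof.
rewrite -[x]SRreprK -[y]SRreprK => xy.
apply/eqP; rewrite qclass_eq; apply/mem_SR_ideal => m mD.
by have := xy m; rewrite !SRcoef_class mD raddfB /= => ->; rewrite subrr.
Qed.

Lemma SRcoef_nonface m x : supp_set m \notin faces Delta -> SRcoef m x = 0.
Proof. by rewrite /SRcoef => /negbTE->. Qed.

Lemma SRcoef_monomial m m' :
  SRcoef m (SRclass Delta 'X_[m']) = if supp_set m \in faces Delta then (m' == m)%:R else 0.
Proof. by rewrite SRcoef_class mcoeffX. Qed.

Lemma SRcoef_mulX m m' x : SRcoef m (SRclass Delta 'X_[m'] * x) =
  if (supp_set m \in faces Delta) && (m' <= m)%MM then SRcoef (m - m') x else 0.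
Proof.
rewrite -[x]SRreprK -rmorphM !SRcoef_class mulrC mcoeffMXE.
case: ifP => //= mD; case: ifP => // mm'.
rewrite (face_subset _ mD) //; apply: supp_set_le; exact: lem_subr.
Qed.

Lemma SR_homogP (d : int) x :
  x \in SR_homog k Delta d <-> forall m, SRcoef m x != 0 -> (mdeg m)%:Z = d.
Proof.
split.
  case: d => d /asboolP => [[p pd ->]|->] m; last by rewrite linear0 eqxx.
  rewrite SRcoef_class; case: ifP; last by rewrite eqxx.
  move=> _; rewrite -mcoeff_msupp => mp; congr Posz.
  by move/dhomogP: pd; apply.
move=> xd.
(* This is the representative stripped of its non-face monomials; an arbitrary representative need
   not be homogeneous. *)
pose p : A := \sum_(m <- msupp (SRrepr x)) SRcoef m x *: 'X_[m].
have xE : x = SRclass Delta p.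
  apply: SRcoefP => m; rewrite SRcoef_class raddf_sum /=.
  case: ifP => mD; last by rewrite SRcoef_nonface ?mD.
  rewrite {1}/SRcoef mD -mcoeff_sum_msupp; apply: eq_bigr => m' _.
  rewrite mcoeffZ mcoeffX; case: eqP => [->|]; last by rewrite !mulr0.
  by rewrite /SRcoef mD.
case: d xd => d xd; apply/asboolP; last first.
  by apply: SRcoefP => m; rewrite linear0; apply/eqP; apply: contraT => /xd.
exists p => //; apply: rpred_sum => m _.
have [->|/xd[] <-] := eqVneq (SRcoef m x) 0; first by rewrite scale0r rpred0.
by rewrite rpredZ // dhomogX.
Qed.

(** Monomials whose exponent at v is exactly t are dropped too. Thus v stays in the support of every
    quotient, division preserves supports, and the coefficients of the result depend only on those
    of x. *)
Definition SRdiv (t : nat) v x : SR := SRclass Delta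
  (\sum_(m <- msupp (SRrepr x)) if (t < m v)%N then (SRrepr x)@_m *: 'X_[m - U_(v) *+ t] else 0).

Lemma SRcoef_div t v x m : SRcoef m (SRdiv t v x) =
  if (0 < m v)%N then SRcoef (m + U_(v) *+ t) x else 0.
Proof.
rewrite SRcoef_class raddf_sum /=.
(* When v is already in the support, a further factor x_v^t does not change the support. *)
have suppE : (0 < m v)%N -> supp_set (m + U_(v) *+ t) = supp_set m.
  move=> mv; apply/setP => u; rewrite !inE mnmDE mulmnE mnm1E.
  by case: eqVneq => [<-|_]; rewrite ?mul0n ?addn0 // addn_gt0 mv.
case: ifP => mD; last by case: ifP => // mv; rewrite SRcoef_nonface // suppE ?mD.
set m1 := (m + U_(v) *+ t)%MM.
transitivity (\sum_(m' <- msupp (SRrepr x))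
    (SRrepr x)@_m' * ((m' == m1) && (0 < m v)%N)%:R).
  apply: eq_bigr => m' _.
  have -> : (m' == m1) && (0 < m v)%N = (t < m' v)%N && ((m' - U_(v) *+ t)%MM == m).
    apply/idP/idP => [/andP[/eqP-> mv]|/andP[tm' /eqP mE]].
      by rewrite addmK mnmDE mulmnE mnm1E eqxx mul1n eqxx andbT -{1}[t]add0n ltn_add2r.
    rewrite /m1 -mE mnmBE mulmnE mnm1E eqxx mul1n subn_gt0 tm' submK ?eqxx //.
    apply/mnm_lepP => u; rewrite mulmnE mnm1E.
    by case: eqVneq => [<-|]; rewrite ?mul1n // ltnW.
  by case: ifP => _; rewrite ?mcoeff0 ?mulr0 // mcoeffZ mcoeffX.
case: ifP => mv; last by rewrite big1 // => m' _; rewrite andbF mulr0.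
rewrite -[x in RHS]SRreprK.
under eq_bigr do rewrite andbT.
by rewrite mcoeff_sum_msupp SRcoef_class suppE ?mD.
Qed.

End StanleyReisnerCoefficients.

(** * The Koszul complex and the contraction of its positive degrees *)

Section KoszulContraction.
Variable n : nat.
Implicit Types (v w : 'I_n) (rho : {set 'I_n}) (m : 'X_{1..n}).

Lemma pos_setD1 v rho : pos v (rho :\ v) = pos v rho.
Proof.
rewrite /pos; apply: eq_card => u; rewrite !inE.
by case: eqVneq => [->|//]; rewrite ltnn !andbF.
Qed.

(** Exactly one of v < w and w < v holds, so exactly one of the two positions changes. This is the
    sign that makes the cross terms cancel in the homotopy formula. *)
Lemma odd_pos_setU1D1 v w rho : v \notin rho -> w \in rho ->
  odd (pos w rho + pos v (rho :\ w)) = ~~ odd (pos w (v |: rho) + pos v rho).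
Proof.
move=> v_rho w_rho; rewrite !posE big_setU1 //=.
rewrite [X in _ = ~~ odd (_ + X)](big_setD1 w) //=.
set a := (\sum_(u in rho) (u < w))%N; set b := (\sum_(u in rho :\ w) (u < v))%N.
have vw : v != w :> nat by apply: contraNneq v_rho => /val_inj ->.
by rewrite !oddD; case: ltngtP vw => // _ _; case: (odd a); case: (odd b).
Qed.

Variables (k : fieldType) (Delta : simplicial_complex n).
Local Notation koszul_cochain := {ffun {set 'I_n} -> SR k Delta}.

Lemma mnmU_le t v m : (U_(v) *+ t <= m)%MM = (t <= m v)%N.
Proof.
apply/mnm_lepP/idP => [/(_ v)|tm u]; rewrite mulmnE mnm1E.
  by rewrite eqxx mul1n.
by case: eqVneq => [<-|]; rewrite ?mul1n.
Qed.

Lemma SRcoef_koszul_diff t (f : koszul_cochain) rho m :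
  SRcoef m (koszul_diff t f rho) = \sum_(v in rho) (-1) ^+ pos v rho *
    if (supp_set m \in faces Delta) && (t <= m v)%N
    then SRcoef (m - U_(v) *+ t) (f (rho :\ v)) else 0.
Proof.
rewrite ffunE raddf_sum /=; apply: eq_bigr => v _.
by rewrite linearZ /SRvar -rmorphXn /= mpolyXn SRcoef_mulX mnmU_le.
Qed.

Lemma koszul_cochainB (f g : koszul_cochain) rho : (f - g) rho = f rho - g rho.
Proof. by rewrite !ffunE. Qed.

Lemma koszul_diffD t (f g : koszul_cochain) :
  koszul_diff t (f + g) = koszul_diff t f + koszul_diff t g.
Proof. by have := koszul_diff_linear t 1 f g; rewrite !scale1r. Qed.

Lemma koszul_diff0 t : koszul_diff t (0 : koszul_cochain) = 0.
Proof. by apply: (addrI (koszul_diff t 0)); rewrite -koszul_diffD !addr0. Qed.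

Lemma koszul_diffB t (f g : koszul_cochain) :
  koszul_diff t (f - g) = koszul_diff t f - koszul_diff t g.
Proof. by have := koszul_diffD t (f - g) g; rewrite subrK => ->; rewrite addrK. Qed.

Lemma koszul_diff_cochains t j i f : f \in koszul_cochains k Delta t j i ->
  koszul_diff t f \in koszul_cochains k Delta t j (i + 1).
Proof.
move=> /forallP fC; apply/forallP => rho; rewrite ffunE.
have sizeE v : v \in rho -> (#|rho|%:Z == i + 1) = (#|rho :\ v|%:Z == i).
  move=> v_rho; rewrite (cardsD1 v) v_rho PoszD addrC.
  by rewrite (inj_eq (addIr _)).
case: ifP => rho_i; last first.
  apply/eqP; apply: big1 => v v_rho; have := fC (rho :\ v).
  by rewrite -sizeE // rho_i => /eqP->; rewrite mulr0 scaler0.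
apply: rpred_sum => v v_rho; apply: rpredZ; have := fC (rho :\ v).
rewrite -sizeE // rho_i (cardsD1 v rho) v_rho => fh.
rewrite /SRvar -rmorphXn /= mpolyXn mulnDr muln1 PoszD -addrA.
by apply: SR_homogM => //; rewrite dhomogX; apply/eqP; rewrite /= mdegMn mdeg1 mul1n.
Qed.

Lemma koszul_diff_diff t (f : koszul_cochain) : koszul_diff t (koszul_diff t f) = 0.
Proof.
apply/ffunP => rho; rewrite ffunE.
pose F v w : SR k Delta := ((-1) ^+ pos v rho * (-1) ^+ pos w (rho :\ v)) *:
  (SRvar k Delta v ^+ t * (SRvar k Delta w ^+ t * f (rho :\ v :\ w))).
(* Removing the smaller element first lowers the position of the larger one by one, while removing
   the larger first does not affect the smaller; hence opposite signs. *)
have FC v w : v \in rho -> w \in rho -> (v < w)%N -> F w v = - F v w.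
  move=> v_rho w_rho vw; rewrite /F -scaleNr mulrCA; congr (_ *: (_ * (_ * f _))); last first.
    by apply/setP => u; rewrite !inE andbCA.
  have pv : pos v (rho :\ w) = pos v rho.
    rewrite !posE [RHS](big_setD1 w) //=.
    by rewrite ltnNge ltnW.
  have pw : pos w rho = (pos w (rho :\ v)).+1.
    by rewrite !posE (big_setD1 v) //= vw.
  by rewrite pv pw exprS mulN1r mulNr mulrC.
transitivity (\sum_(v in rho) \sum_(w in rho | w != v) F v w).
  apply: eq_bigr => v _; rewrite ffunE mulr_sumr scaler_sumr.
  apply: eq_big => [w|w _]; first by rewrite !inE andbC.
  by rewrite -SR_scalerAr scalerA.
have splitE v : \sum_(w in rho | w != v) F v w =
    \sum_(w in rho | (v < w)%N) F v w + \sum_(w in rho | (w < v)%N) F v w.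
  rewrite (bigID (fun w : 'I_n => (v < w)%N)) /=; congr (_ + _); apply: eq_bigl => w.
    by case: (w \in rho) => //=; rewrite -(inj_eq val_inj) /=; case: ltngtP.
  by case: (w \in rho) => //=; rewrite -(inj_eq val_inj) /=; case: ltngtP.
under eq_bigr do rewrite splitE.
rewrite big_split /=.
have -> : \sum_(v in rho) \sum_(w in rho | (w < v)%N) F v w =
    \sum_(v in rho) \sum_(w in rho | (v < w)%N) F w v.
  rewrite (exchange_big_dep (mem rho)) /= => [|v w _ /andP[]//].
  by apply: eq_bigr => v v_rho; apply: eq_bigl => w; rewrite v_rho.
rewrite -big_split ffunE /=; apply: big1 => v v_rho.
rewrite -big_split big1 //= => w /andP[w_rho vw].
by rewrite (FC v w) // subrr.
Qed.

(* Contracts the part of the complex of degrees a with a_v > 0. *)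
Definition koszul_contract t v (f : koszul_cochain) : koszul_cochain :=
  [ffun rho : {set 'I_n} => if v \in rho then 0
     else (-1 : k) ^+ pos v rho *: SRdiv t v (f (v |: rho))].

(** On a cocycle the homotopy formula dh + hd reduces to dh, which is the projection onto the
    degrees a = m - t rho with a_v > 0; the test in the conclusion expresses a_v > 0. *)
Lemma koszul_contract_diff t v f rho m : koszul_diff t f = 0 ->
  SRcoef m (koszul_diff t (koszul_contract t v f) rho) =
  if ((v \in rho) * t < m v)%N then SRcoef m (f rho) else 0.
Proof.
move=> df0; have [mD|mD] := boolP (supp_set m \in faces Delta); last first.
  by rewrite !SRcoef_nonface // if_same.
rewrite SRcoef_koszul_diff mD /=; have [v_rho|v_rho] := boolP (v \in rho).
  (* Only the term of v survives: removing any other w leaves v in the set, where the contraction is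
     0. *)
  rewrite mul1n (bigD1 v) //= big1 ?addr0 => [|w /andP[w_rho wv]]; last first.
    rewrite ffunE !inE v_rho eq_sym wv /= linear0.
    by rewrite if_same mulr0.
  rewrite ffunE !inE eqxx /= pos_setD1 linearZ /= SRcoef_div setD1K //.
  rewrite mnmBE mulmnE mnm1E eqxx mul1n subn_gt0.
  (* At m v = t the contraction gives 0 because [SRdiv] is strict, and a_v = 0 there. *)
  case: ltngtP => [mt|tm|tm]; rewrite ?ltnn ?scaler0 ?mulr0 //.
  rewrite submK ?mnmU_le ?(ltnW mt) //.
  by rewrite -[_ *: _]/(_ * _) mulrA -expr2 sqrr_sign mul1r.
rewrite [(false * t)%N]mul0n; case: ifP => mv; last first.
  rewrite big1 // => w w_rho; have wv : v != w by apply: contraNneq v_rho => ->.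
  rewrite ffunE !inE (negbTE v_rho) andbF linearZ /= SRcoef_div mnmBE mulmnE mnm1E.
  by rewrite eq_sym (negbTE wv) subn0 mv scaler0 if_same mulr0.
(* The cocycle equation is read at v |: rho on the monomial m + t e_v. Up to sign its term for v is
   the coefficient of m in f rho, and its other terms are those of the differential of the
   contraction. *)
have := congr1 (fun g : koszul_cochain => SRcoef (m + U_(v) *+ t) (g (v |: rho))) df0.
have suppE : supp_set (m + U_(v) *+ t) = supp_set m.
  apply/setP => u; rewrite !inE mnmDE mulmnE mnm1E.
  by case: eqVneq => [<-|_]; rewrite ?mul0n ?addn0 // addn_gt0 mv.
rewrite /= SRcoef_koszul_diff suppE mD ffunE linear0 big_setU1 //=.
rewrite setU1K // mnmDE mulmnE mnm1E eqxx mul1n leq_addl addmK.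
move=> /eqP; rewrite addr_eq0 => /eqP /(congr1 ( *%R ((-1) ^+ pos v (v |: rho)))).
rewrite mulrA -expr2 sqrr_sign mul1r => ->; rewrite mulrN mulr_sumr -sumrN.
apply: eq_bigr => w w_rho; have wv : v != w by apply: contraNneq v_rho => ->.
rewrite ffunE !inE (negbTE v_rho) andbF linearZ /= SRcoef_div mnmBE mulmnE mnm1E.
rewrite eq_sym (negbTE wv) subn0 mv mnmDE mulmnE mnm1E (negbTE wv) mul0n addn0.
case: ifP => tm; last by rewrite !mulr0 oppr0.
have -> : (v |: rho) :\ w = v |: rho :\ w.
  by apply/setP => u; rewrite !inE; case: (u =P v) => [->|]; rewrite ?wv.
have -> : (m - U_(w) *+ t + U_(v) *+ t = m + U_(v) *+ t - U_(w) *+ t)%MM.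
  by rewrite addmC addmBA ?mnmU_le // addmC.
rewrite -[_ *: _]/(_ * _) !mulrA -!exprD -mulNr; congr (_ * _).
rewrite -signr_odd odd_pos_setU1D1 // -[in RHS]signr_odd.
rewrite -[pos v (v |: rho)]pos_setD1 setU1K // [in RHS]addnC.
by case: (odd _); rewrite ?opprK.
Qed.

Lemma koszul_contract_cochains t j i v f :
  f \in koszul_cochains k Delta t j i ->
  koszul_contract t v f \in koszul_cochains k Delta t j (i - 1).
Proof.
move=> /forallP fC; apply/forallP => rho; rewrite ffunE.
have [v_rho|v_rho] := boolP (v \in rho); first by case: ifP; rewrite ?rpred0.
have := fC (v |: rho); rewrite cardsU1 v_rho add1n.
have -> : (#|rho|.+1%:Z == i) = (#|rho|%:Z == i - 1).
  by rewrite intS addrC eq_sym -subr_eq eq_sym.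
case: ifP => _ => [/SR_homogP fh|/eqP ->]; last first.
  apply/eqP; rewrite -[RHS](scaler0 _ ((-1) ^+ pos v rho)); congr (_ *: _).
  by apply: SRcoefP => m; rewrite SRcoef_div !linear0 if_same.
rewrite rpredZ //; apply/SR_homogP => m; rewrite SRcoef_div.
case: ifP => mv; last by rewrite eqxx.
move=> /fh; rewrite mdegD mdegMn mdeg1 mul1n mulnS => E.
apply/eqP; rewrite -(inj_eq (addIr t%:Z)) -PoszD E PoszD.
by rewrite -addrA addrC.
Qed.

(* The variables are treated one after the other; a single homotopy for all of them
   would have to choose a v with a_v > 0 for each degree a. *)
Lemma koszul_reduce t j i f :
  f \in koszul_cochains k Delta t j i -> koszul_diff t f = 0 ->
  exists2 b, b \in koszul_cochains k Delta t j (i - 1) &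
    forall rho m, SRcoef m ((f - koszul_diff t b) rho) =
      if (m <= set_mnm t rho)%MM then SRcoef m (f rho) else 0.
Proof.
move=> fC df.
suff [b bC bE] : exists2 b, b \in koszul_cochains k Delta t j (i - 1) &
    forall rho m, SRcoef m ((f - koszul_diff t b) rho) =
      if all (fun v => (m v <= (v \in rho) * t)%N) (enum 'I_n) then SRcoef m (f rho) else 0.
  exists b => // rho m; rewrite bE; congr (if _ then _ else _).
  apply/allP/mnm_lepP => le v; first by rewrite mnmE le ?mem_enum.
  by move=> _; have := le v; rewrite mnmE.
elim: (enum 'I_n) => [|v s [b bC bE]].
  exists 0 => [|rho m]; first exact: rpred0.
  by rewrite koszul_diff0 subr0.
set f' := f - koszul_diff t b.
have f'C : f' \in koszul_cochains k Delta t j i.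
  by apply: (rpredB fC); have := koszul_diff_cochains bC; rewrite subrK.
have df' : koszul_diff t f' = 0.
  by rewrite koszul_diffB df koszul_diff_diff subr0.
(* Subtracting the differential of the contraction of f' deletes the coefficients with a_v > 0 and
   keeps the others, so what was achieved for the variables in s persists. *)
exists (b + koszul_contract t v f') => [|rho m].
  exact: (rpredD bC (koszul_contract_cochains v f'C)).
rewrite koszul_diffD opprD addrA -/f' koszul_cochainB raddfB /=.
rewrite koszul_contract_diff // /=.
by case: ltnP => _ /=; rewrite ?subrr ?subr0 ?bE.
Qed.

End KoszulContraction.

(** * The Hochster-Graebe map on cochains and its inverse *)

Section HochsterGraebeCochains.
Variables (k : fieldType) (n : nat) (Delta : simplicial_complex n) (j : nat).
Local Notation cochain := {ffun {set 'I_n} -> k^o}.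
Local Notation koszul_cochain := {ffun {set 'I_n} -> SR k Delta}.
Implicit Types (U : multidegree Delta j) (rho : {set 'I_n}) (m : 'X_{1..n}).
Implicit Types (c : multidegree Delta j -> cochain) (f : koszul_cochain).

Definition rel_family (l : int) c :=
  forall U, c U \in rel_cochains k Delta (cost Delta (supp_set U)) l.

Lemma multidegree_le U v : (U v <= j)%N.
Proof.
case: U => U /= /andP[/eqP <- _]; rewrite mdegE (bigD1 v) //=; exact: leq_addr.
Qed.

Lemma multidegree_le_set t U rho : (j <= t)%N -> supp_set U \subset rho ->
  (U <= set_mnm t rho)%MM.
Proof.
move=> jt /subsetP U_rho; apply/mnm_lepP => v; rewrite mnmE.
have := U_rho v; rewrite inE; case: (posnP (U v)) => [-> //|_ /(_ isT) ->].
by rewrite mul1n (leq_trans (multidegree_le U v)).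
Qed.

(** Since U_v <= j < t, every exponent t - U_v with v in rho is positive. *)
Lemma supp_set_mnmB t U rho : (j < t)%N -> supp_set (set_mnm t rho - U) = rho.
Proof.
move=> jt; apply/setP => v; rewrite inE mnmBE mnmE.
case: (v \in rho); last by rewrite mul0n sub0n.
by rewrite mul1n subn_gt0 (leq_ltn_trans (multidegree_le U v)).
Qed.

Lemma mdeg_set_mnm t rho : mdeg (set_mnm t rho) = (t * #|rho|)%N.
Proof.
rewrite mdegE -sum1_card big_distrr [RHS]big_mkcond /=; apply: eq_bigr => v _.
by rewrite mnmE; case: (v \in rho); rewrite ?mul1n ?muln1.
Qed.

Lemma set_mnmD1 t v rho : v \in rho ->
  (set_mnm t (rho :\ v) + U_(v) *+ t)%MM = set_mnm t rho.
Proof.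
move=> v_rho; apply/mnmP => u; rewrite mnmDE mulmnE mnm1E !mnmE !inE eq_sym.
by case: eqVneq => [<-|_]; rewrite ?v_rho // addn0.
Qed.

Lemma set_mnm_supp t m rho : (m <= set_mnm t rho)%MM -> supp_set m \subset rho.
Proof.
move=> /mnm_lepP le; apply/subsetP => v; rewrite inE => mv.
by have := leq_trans mv (le v); rewrite mnmE; case: (v \in rho).
Qed.

Lemma rel_cochain_eq0 (s : {set 'I_n}) l (c : cochain) rho :
  c \in rel_cochains k Delta (cost Delta s) l ->
  ~~ ((rho \in faces Delta) && (s \subset rho)) -> c rho = 0.
Proof.
move=> /forallP/(_ rho)/orP[/and3P[rhoD]|/eqP-> //].
by rewrite !inE rhoD negbK => ->.
Qed.

Lemma coboundary_cochains (s : {set 'I_n}) l (c : cochain) :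
  c \in rel_cochains k Delta (cost Delta s) l ->
  coboundary Delta c \in rel_cochains k Delta (cost Delta s) (l + 1).
Proof.
move=> /forallP cC; apply/forallP => sigma; rewrite ffunE.
case: ifP => sigmaD; last by rewrite eqxx orbT.
rewrite !inE sigmaD negbK /=.
case: (boolP (_ && _)) => //= bad; apply/eqP; apply: big1 => v v_sigma.
case/orP: (cC (sigma :\ v)) => [/and3P[vD]|/eqP->]; last by rewrite scaler0.
rewrite !inE vD negbK => s_sub size_v; case/negP: bad; apply/andP; split.
  exact: subset_trans s_sub (subsetDl _ _).
by rewrite (cardsD1 v) v_sigma PoszD addrC (inj_eq (addIr _)).
Qed.

(** The Hochster-Graebe map into the Koszul complex on the powers x_v^t. Level j + 1 is
    [hg_cochain]; the higher levels are needed because elements and relations of the direct limit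
    may appear only there. *)
Definition hg_at (t : nat) c : koszul_cochain :=
  [ffun rho : {set 'I_n} => \sum_(U : multidegree Delta j)
     if (rho \in faces Delta) && (supp_set U \subset rho)
     then (c U rho : k) *: SRclass Delta 'X_[set_mnm t rho - U] else 0].

Lemma hg_cochainE c : hg_cochain c = hg_at j.+1 c.
Proof.
apply/ffunP => rho; rewrite ffunE /hg_cochain sum_ffunE; apply: eq_bigr => U _.
have off sigma : sigma != rho -> (c U sigma *: hg_hom k Delta j U sigma) rho = 0.
  by move=> ne; rewrite 2!ffunE eq_sym (negbTE ne) scaler0.
rewrite sum_ffunE; case: ifPn => rhoP; last first.
  by apply: big1 => sigma sP; apply: off; apply: contraNneq rhoP => <-.
rewrite (bigD1 rho) //= [X in _ + X]big1 ?addr0 => [|sigma /andP[_]]; last exact: off.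
rewrite 2!ffunE eqxx; congr (_ *: SRclass _ 'X_[_]).
by apply/mnmP => v; rewrite mnmBE !mnmE.
Qed.

(** The product of the x_v, v in rho, times x^(t rho - U) is x^((t+1) rho - U), so the maps
    [hg_at t] are compatible with the transition maps. *)
Lemma koszul_trans_hg_at t c : (j < t)%N -> koszul_trans (hg_at t c) = hg_at t.+1 c.
Proof.
move=> jt; apply/ffunP => rho; rewrite !ffunE mulr_sumr; apply: eq_bigr => U _.
case: ifP => [/andP[_ U_rho]|]; last by rewrite mulr0.
rewrite -SR_scalerAr -(rmorph_prod (SRclass Delta)) /= -rmorphM prod_var_mnm /=.
rewrite -mpolyXD addmBA; last exact: multidegree_le_set (ltnW jt) U_rho.
congr (_ *: SRclass _ 'X_[_ - _]); apply/mnmP => v.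
by rewrite mnmDE !mnmE -mulnDr add1n.
Qed.

(** The conditions on rho in [hg_at] disappear because relative cochains vanish where they fail.
    Where they hold, x^(t rho - U) has the face rho as support and so is non-zero in k[Delta]. *)
Lemma SRcoef_hg_at t l c rho m : (j < t)%N -> rel_family l c ->
  SRcoef m (hg_at t c rho) =
    \sum_(U : multidegree Delta j) if (m + U)%MM == set_mnm t rho then c U rho else 0.
Proof.
move=> jt cC; rewrite ffunE raddf_sum; apply: eq_bigr => U _ /=.
case: ifPn => [/andP[rhoD U_rho]|/(rel_cochain_eq0 (cC U)) ->]; last first.
  by rewrite linear0 if_same.
rewrite linearZ /= SRcoef_monomial.
have -> : ((m + U)%MM == set_mnm t rho) = ((set_mnm t rho - U)%MM == m).
  apply/eqP/eqP => [<-|<-]; first by rewrite addmK.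
  by rewrite submK // multidegree_le_set // ltnW.
case: eqP => [<-|_]; last by rewrite if_same scaler0.
by rewrite supp_set_mnmB // rhoD -[_ *: _]/(_ * _) mulr1.
Qed.

(** If [c U] is non-zero at rho :\ v, then U_v = 0, and x_v^t times the monomial at rho :\ v is x^(t
    rho - U). This monomial has support rho, so it dies in k[Delta] exactly when rho is not a face,
    where [coboundary] is 0 as well. *)
Lemma hg_at_diff t l c : (j < t)%N -> rel_family l c ->
  koszul_diff t (hg_at t c) = hg_at t (fun U => coboundary Delta (c U)).
Proof.
move=> jt cC; apply/ffunP => rho; apply: SRcoefP => m.
have dC : rel_family (l + 1) (fun U => coboundary Delta (c U)).
  by move=> U; apply: coboundary_cochains.
rewrite (SRcoef_hg_at _ _ jt dC) SRcoef_koszul_diff.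
have termE v U : v \in rho ->
    (if (supp_set m \in faces Delta) && (t <= m v)%N then
       if (m - U_(v) *+ t + U)%MM == set_mnm t (rho :\ v) then c U (rho :\ v) else 0
     else 0) =
    if ((m + U)%MM == set_mnm t rho) && (rho \in faces Delta) then c U (rho :\ v) else 0.
  move=> v_rho; have [UvP|/(rel_cochain_eq0 (cC U)) ->] :=
    boolP ((rho :\ v \in faces Delta) && (supp_set U \subset rho :\ v)); last first.
    by rewrite !if_same.
  have [_ U_rho] := andP UvP; have := U_rho; rewrite subsetD1 inE -eqn0Ngt.
  move=> /andP[U_rho' /eqP Uv].
  have [mU|mU] := eqVneq (m + U)%MM (set_mnm t rho).
    have mE : m = (set_mnm t rho - U)%MM by rewrite -mU addmK.
    have mv : m v = t by rewrite mE mnmBE Uv mnmE v_rho mul1n subn0.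
    rewrite {1}mE supp_set_mnmB // mv leqnn andbT /=; case: ifP => // _.
    rewrite -(eqm_add2r (U_(v) *+ t)%MM) -addmA [(U + _)%MM]addmC addmA submK ?mnmU_le ?mv //.
    by rewrite mU set_mnmD1 // eqxx.
  case: ifP => //= /andP[_ tv].
  rewrite -(eqm_add2r (U_(v) *+ t)%MM) -addmA [(U + _)%MM]addmC addmA submK ?mnmU_le //.
  by rewrite set_mnmD1 // (negbTE mU).
transitivity (\sum_(v in rho) \sum_(U : multidegree Delta j)
  if ((m + U)%MM == set_mnm t rho) && (rho \in faces Delta)
  then (-1) ^+ pos v rho * c U (rho :\ v) else 0).
  apply: eq_bigr => v v_rho; rewrite (SRcoef_hg_at _ _ jt cC).
  transitivity ((-1) ^+ pos v rho * \sum_(U : multidegree Delta j)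
     if ((m + U)%MM == set_mnm t rho) && (rho \in faces Delta)
     then c U (rho :\ v) else 0).
    congr (_ * _); under [RHS]eq_bigr do rewrite -termE //.
    by case: ifP => // _; rewrite big1.
  by rewrite mulr_sumr; apply: eq_bigr => U _; case: ifP; rewrite ?mulr0.
rewrite exchange_big; apply: eq_bigr => U _; rewrite ffunE.
by case: eqP => _; case: (rho \in faces Delta) => //=; rewrite big1.
Qed.

Lemma hg_at_cochains t i c : (j < t)%N -> rel_family (i - 1) c ->
  hg_at t c \in koszul_cochains k Delta t j i.
Proof.
move=> jt cC; apply/forallP => rho; rewrite ffunE; case: ifP => rho_i.
  apply: rpred_sum => U _; case: ifP => [/andP[_ U_rho]|_]; last exact: rpred0.
  apply: rpredZ; apply/SR_homogP => m; rewrite SRcoef_monomial.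
  case: ifP => _; last by rewrite eqxx.
  have [<- _|_] := eqVneq (set_mnm t rho - U)%MM m; last by rewrite eqxx.
  have := mdegD (set_mnm t rho - U) U; rewrite submK ?mdeg_set_mnm; last first.
    exact: multidegree_le_set (ltnW jt) U_rho.
  by case: (valP U) => /andP[/eqP -> _] ->; rewrite PoszD addrK.
apply/eqP/big1 => U _; case: ifP => // _.
have /forallP/(_ rho)/orP[/and3P[_ _]|/eqP ->] := cC U; last by rewrite scale0r.
by rewrite subrK rho_i.
Qed.

(** For t > j this inverts [hg_at] on families of relative cochains ([hg_atK]) and on homogeneous
    Koszul cochains concentrated in degrees a <= 0 ([hg_coefK]). *)
Definition hg_coef (t : nat) f U : cochain :=
  [ffun rho : {set 'I_n} => if (rho \in faces Delta) && (supp_set U \subset rho)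
     then SRcoef (set_mnm t rho - U) (f rho) else 0].

Lemma hg_coef_cochains t i f : f \in koszul_cochains k Delta t j i ->
  rel_family (i - 1) (hg_coef t f).
Proof.
move=> /forallP fC U; apply/forallP => rho; rewrite ffunE !inE subrK.
have := fC rho; case: ifP => [_ _|_ /eqP->]; last first.
  by rewrite linear0 if_same eqxx orbT.
by case: (_ \in _); case: (_ \subset _); rewrite ?eqxx ?orbT.
Qed.

(** Valid for every Koszul cochain, not only for those in the image of [hg_at]; thus a bounding
    Koszul cochain yields a bounding simplicial one. *)
Lemma hg_coef_diff t f U : (j < t)%N ->
  hg_coef t (koszul_diff t f) U = coboundary Delta (hg_coef t f U).
Proof.
move=> jt; apply/ffunP => rho; rewrite ffunE [RHS]ffunE.
case rhoD: (rho \in faces Delta) => //=.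
case: ifPn => U_rho; last first.
  rewrite big1 // => v _; rewrite ffunE; case: ifP => [/andP[_ Uv]|]; last by rewrite scaler0.
  by case/negP: U_rho; apply: subset_trans Uv (subsetDl _ _).
rewrite SRcoef_koszul_diff; apply: eq_bigr => v v_rho; rewrite ffunE.
rewrite supp_set_mnmB // rhoD (face_subset (subsetDl _ _) rhoD) subsetD1 U_rho /=.
rewrite inE -eqn0Ngt mnmBE mnmE v_rho mul1n.
(* As t > 0, the monomial x^(t rho - U) is divisible by x_v^t only for v outside s(U), which leaves
   the terms with s(U) contained in rho :\ v. *)
have -> : (t <= t - U v)%N = (U v == 0%N).
  have := multidegree_le U v; case: (U v) => [|u ut]; first by rewrite subn0 leqnn.
  by rewrite leqNgt ltn_subrL (leq_ltn_trans _ jt).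
case: ifP => // _; congr (_ * _); congr (SRcoef _ _).
by rewrite submDA addmC -submDA -(set_mnmD1 t v_rho) addmK.
Qed.

Lemma hg_atK t l c : (j < t)%N -> rel_family l c -> hg_coef t (hg_at t c) = c.
Proof.
move=> jt cC; apply: functional_extensionality_dep => U; apply/ffunP => rho.
rewrite ffunE (SRcoef_hg_at _ _ jt cC).
case: ifPn => [/andP[_ U_rho]|/(rel_cochain_eq0 (cC U)) -> //].
rewrite -big_mkcond (big_pred1 U) // => U' /=.
have U_le := multidegree_le_set (ltnW jt) U_rho.
rewrite -[X in _ == X](submK U_le); apply/eqP/eqP => [|->] //.
by move/addmI/val_inj.
Qed.

(** A monomial m occurring at rho has degree -U0 with U0 = t rho - m >= 0; homogeneity and t > j
    make U0 an element of T(Delta)_j and rho the support of m. *)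
Lemma hg_coefK t i f : (j < t)%N -> f \in koszul_cochains k Delta t j i ->
  (forall rho m, SRcoef m (f rho) != 0 -> (m <= set_mnm t rho)%MM) ->
  hg_at t (hg_coef t f) = f.
Proof.
move=> jt fC f_le; apply/ffunP => rho; apply: SRcoefP => m.
rewrite (SRcoef_hg_at _ _ jt (hg_coef_cochains fC)).
have [fm0|fm] := eqVneq (SRcoef m (f rho)) 0.
  rewrite fm0 big1 // => U _; case: eqP => // mU; rewrite ffunE.
  by rewrite -mU addmK fm0 if_same.
pose U0 := (set_mnm t rho - m)%MM; have U0E := submK (f_le _ _ fm).
have := forallP fC rho; case: ifP => [_ /SR_homogP/(_ _ fm) fh|_ /eqP f0]; last first.
  by rewrite f0 linear0 eqxx in fm.
(* By homogeneity |m| = t|rho| - j. *)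
have mdegU0 : mdeg U0 = j.
  have := congr1 (fun m => (mdeg m)%:Z) U0E; rewrite /= mdegD PoszD fh mdeg_set_mnm.
  by rewrite addrCA -[RHS]addr0 => /addrI/eqP; rewrite subr_eq0 => /eqP[].
have mD : supp_set m \in faces Delta.
  by apply: contraR fm => /SRcoef_nonface ->; rewrite eqxx.
have U0_rho : supp_set U0 \subset rho by apply: (@set_mnm_supp t); apply: lem_subr.
(* If m_v were 0 for some v in rho, then U0_v = t > j = |U0|, which is absurd. *)
have rhoE : supp_set m = rho.
  apply/eqP; rewrite eqEsubset (set_mnm_supp (f_le _ _ fm)) /=.
  apply/subsetP => v v_rho; rewrite inE lt0n; apply: contraTneq jt => mv.
  have := congr1 (fun u : 'X_{1..n} => u v) U0E.
  rewrite /= mnmDE [set_mnm t rho v]mnmE v_rho mv addn0 mul1n => <-.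
  by rewrite -leqNgt -mdegU0 mdegE (bigD1 v) //= leq_addr.
have U0P : (mdeg U0 == j) && (supp_set U0 \in faces Delta).
  by rewrite mdegU0 eqxx; apply: (face_subset U0_rho); rewrite -rhoE.
pose U : multidegree Delta j := Multidegree U0P.
rewrite -big_mkcond (big_pred1 U) => [|U'] /=.
  rewrite ffunE -{1}rhoE mD U0_rho /=; congr (SRcoef _ _).
  by rewrite -[RHS](addmK U0) addmC U0E.
by rewrite -U0E addmC eqm_add2r.
Qed.

End HochsterGraebeCochains.

(** * Elements of a direct limit *)

Section DirectLimitElements.
Variables (R : pzRingType) (H : nat -> lmodType R).
Variable phi : forall t, {linear H t -> H t.+1}.
Implicit Types (t s N : nat).

Lemma dfwith_linear t a (h h' : H t) s :
  dfwith (fun u => 0 : H u) (a *: h + h') s =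
  a *: dfwith (fun u => 0 : H u) h s + dfwith (fun u => 0 : H u) h' s.
Proof.
have [<-|ts] := eqVneq t s; first by rewrite !dfwith_in.
by rewrite !dfwith_out // scaler0 addr0.
Qed.

Lemma dirlim_seq_linear t a (h h' : H t) s : dirlim_seq phi (a *: h + h') s =
  a *: dirlim_seq phi h s + dirlim_seq phi h' s.
Proof.
elim: s => [|s IH]; first exact: dfwith_linear.
by rewrite /= dfwith_linear IH linearP scalerDr addrACA.
Qed.

Lemma dirlim_seq_lt t (h : H t) s : (s < t)%N -> dirlim_seq phi h s = 0.
Proof.
elim: s => [|s IH] st; rewrite /= dfwith_out ?gtn_eqF //.
by rewrite IH ?linear0 ?addr0 // ltnW.
Qed.

Lemma dirlim_seq_id t (h : H t) : dirlim_seq phi h t = h.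
Proof.
case: t h => [|t] h; rewrite /= dfwith_in //.
by rewrite dirlim_seq_lt // linear0 addr0.
Qed.

Lemma dirlim_seqS t (h : H t) s : (t <= s)%N ->
  dirlim_seq phi h s.+1 = phi s (dirlim_seq phi h s).
Proof. by move=> ts; rewrite /= dfwith_out ?add0r // neq_ltn ltnS ts. Qed.

(** From position t on, both sequences follow the transition maps and start with the same term.
    Hence in the limit a sequence is represented by any of its terms past which it is compatible. *)
Lemma ev_compatible_seq t (F : Defs.dprod H) :
  (forall s, (t <= s)%N -> F s.+1 = phi s (F s)) ->
  forall s, (t <= s)%N -> dirlim_seq phi (F t) s = F s.
Proof.
move=> FE; elim=> [|s IH] ts.
  by move: ts; rewrite leqn0 => /eqP t0; rewrite t0 dirlim_seq_id.
move: ts; rewrite leq_eqVlt => /predU1P[->|ts]; first exact: dirlim_seq_id.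
by rewrite dirlim_seqS // IH // FE.
Qed.

Lemma sqclass_ev_eq (F G : Defs.dprod H) : F \in ev_compatible phi -> G \in ev_compatible phi ->
  (exists N, forall s, (N <= s)%N -> F s = G s) <->
  sqclass (ev_compatible phi) (@ev_zero _ H) F = sqclass (ev_compatible phi) (@ev_zero _ H) G.
Proof.
move=> FC GC; split=> [[N FG]|/eqP].
  apply/eqP; rewrite sqclass_eq //; apply/asboolP; exists N => s /FG FGs.
  by rewrite -[LHS]/(F s - G s) FGs subrr.
rewrite sqclass_eq // => /asboolP[N FG]; exists N => s /FG /eqP.
by rewrite -[X in X == _]/(F s - G s) subr_eq0 => /eqP.
Qed.

Lemma dirlim_in_linear t : linear (dirlim_in phi (t := t)).
Proof.
move=> a h h'; rewrite /dirlim_in -sqclassP ?dirlim_seq_compatible //.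
by congr sqclass; apply: functional_extensionality_dep => s; apply: dirlim_seq_linear.
Qed.
HB.instance Definition _ t := GRing.isLinear.Build R (H t) (dirlim phi) _
  (dirlim_in phi (t := t)) (@dirlim_in_linear t).

Lemma dirlim_in_seq t (h : H t) s : (t <= s)%N ->
  dirlim_in phi (dirlim_seq phi h s) = dirlim_in phi h.
Proof.
move=> ts; apply/(sqclass_ev_eq (dirlim_seq_compatible _ _) (dirlim_seq_compatible _ _)).
exists s; apply: (@ev_compatible_seq s (dirlim_seq phi h)) => u su.
by rewrite dirlim_seqS // (leq_trans ts).
Qed.

Lemma dirlim_in_eq0 t (h : H t) : dirlim_in phi h = 0 ->
  exists2 s, (t <= s)%N & dirlim_seq phi h s = 0.
Proof.
move=> h0; have : dirlim_in phi h = dirlim_in phi (0 : H t) by rewrite h0 linear0.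
move/(sqclass_ev_eq (dirlim_seq_compatible _ _) (dirlim_seq_compatible _ _)) => [N FG].
exists (maxn t N); first exact: leq_maxl.
rewrite FG ?leq_maxr //.
by have := dirlim_seq_linear (-1) (0 : H t) 0 (maxn t N); rewrite scaler0 addr0 scaleN1r addNr.
Qed.

(** The stage can be taken as late as desired; this matters because the comparison with simplicial
    cochains requires t > j. *)
Lemma dirlim_inP (x : dirlim phi) N :
  exists t (h : H t), (N <= t)%N /\ x = dirlim_in phi h.
Proof.
rewrite -[x]sqreprK; set F := sqrepr x.
have FC : F \in ev_compatible phi by apply: sqrepr_in.
have /asboolP[M FM] := FC; exists (maxn N M), (F (maxn N M)); split; first exact: leq_maxl.
apply/(sqclass_ev_eq FC (dirlim_seq_compatible _ _)); exists (maxn N M) => s sN.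
rewrite (ev_compatible_seq _ sN) // => u; rewrite geq_max => /andP[_]; exact: FM.
Qed.

Lemma dirlim_map_in (f : forall t, {linear H t -> H t}) t (h : H t) :
  (forall t h, f t.+1 (phi t h) = phi t (f t h)) ->
  dirlim_map f (dirlim_in phi h) = dirlim_in phi (f t h).
Proof.
move=> f_phi.
rewrite /dirlim_map /dirlim_in sqmap_class ?dirlim_seq_compatible //.
- apply/(sqclass_ev_eq (dprod_map_compatible f_phi (dirlim_seq_compatible _ _))
    (dirlim_seq_compatible _ _)); exists t => s ts.
  rewrite /dprod_map; symmetry; rewrite -{1}[h](dirlim_seq_id h).
  apply: (@ev_compatible_seq t (fun s => f s (dirlim_seq phi h s))) => // u tu.
  by rewrite dirlim_seqS // f_phi.
- exact: dprod_map_compatible.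
- by move=> F _; apply: dprod_map_zero.
Qed.

End DirectLimitElements.

(** * Cohomology classes and their representatives *)

Section Classes.
Variables (R : pzRingType) (V : lmodType R) (d : {linear V -> V}).
Variables (C : int -> submodule V) (i : int).

Lemma mem_cocycles c : c \in cocycles d C i <-> c \in C i /\ d c = 0.
Proof. by rewrite inE; split=> [/andP[cC /eqP]|[-> ->]] //; rewrite eqxx. Qed.

Lemma cohclassP (x : cohomology d C i) :
  exists c, [/\ c \in C i, d c = 0 & x = cohclass d C i c].
Proof.
have /mem_cocycles[xC dx] := sqrepr_in x.
by exists (sqrepr x); rewrite /cohclass sqreprK.
Qed.

Lemma cohclass_linear a b c : b \in cocycles d C i -> c \in cocycles d C i ->
  cohclass d C i (a *: b + c) = a *: cohclass d C i b + cohclass d C i c.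
Proof. exact: sqclassP. Qed.

Lemma cohclass0 : cohclass d C i 0 = 0.
Proof.
have Z0 : 0 \in cocycles d C i := rpred0 _.
by have := cohclass_linear (-1) Z0 Z0; rewrite scaler0 addr0 scaleN1r addNr.
Qed.

Lemma cohclass_eq b c : b \in cocycles d C i -> c \in cocycles d C i ->
  cohclass d C i b = cohclass d C i c <-> exists2 e, e \in C (i - 1) & b - c = d e.
Proof.
move=> bZ cZ; split=> [/eqP|[e eC bc]].
  by rewrite sqclass_eq // => /asboolP.
by apply/eqP; rewrite sqclass_eq //; apply/asboolP; exists e.
Qed.

End Classes.

(** * Classes in the Koszul cohomology that computes Ext *)

Section ExtClasses.
Variables (k : fieldType) (n : nat) (Delta : simplicial_complex n) (i : int) (j : nat).
Local Notation koszul_cochain := {ffun {set 'I_n} -> SR k Delta}.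
Implicit Types (f g : koszul_cochain) (t : nat).

Definition ext_class t f : ext k Delta i j t := cohclass _ _ i f.

Definition koszul_cocycle t f := f \in koszul_cochains k Delta t j i /\ koszul_diff t f = 0.

Lemma koszul_cocycle0 t : koszul_cocycle t 0.
Proof. by split; [exact: rpred0 | exact: koszul_diff0]. Qed.

Lemma ext_class0 t : ext_class t 0 = 0.
Proof. exact: cohclass0. Qed.

Lemma ext_classP t (x : ext k Delta i j t) : exists2 f, koszul_cocycle t f & x = ext_class t f.
Proof. by have [f [fC df xE]] := cohclassP x; exists f. Qed.

Lemma ext_class_eq t f g : koszul_cocycle t f -> koszul_cocycle t g ->
  ext_class t f = ext_class t g <->
  exists2 b, b \in koszul_cochains k Delta t j (i - 1) & f - g = koszul_diff t b.
Proof. by move=> /mem_cocycles fZ /mem_cocycles gZ; apply: cohclass_eq. Qed.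

Lemma ext_class_linear t a f g : koszul_cocycle t f -> koszul_cocycle t g ->
  ext_class t (a *: f + g) = a *: ext_class t f + ext_class t g.
Proof. by move=> /mem_cocycles fZ /mem_cocycles gZ; apply: cohclass_linear. Qed.

Lemma ext_trans_class t f : koszul_cocycle t f ->
  ext_trans (ext_class t f) = ext_class t.+1 (koszul_trans f).
Proof.
move=> /mem_cocycles fZ; apply: cohmap_class fZ => [l g|g].
  exact: koszul_trans_cochains.
exact: koszul_trans_diff.
Qed.

Lemma ext_act_class (gT : finGroupType) (to : simplicial_action gT Delta) h t f :
  koszul_cocycle t f -> ext_act to h (ext_class t f) = ext_class t (koszul_act to h f).
Proof.
move=> /mem_cocycles fZ; apply: cohmap_class fZ => [l g|g].
  exact: koszul_act_cochains.
exact: koszul_act_diff.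
Qed.

End ExtClasses.

(** * The Hochster-Graebe isomorphism *)

Section HochsterGraebeMap.
Variables (k : fieldType) (n : nat) (Delta : simplicial_complex n) (i : int) (j : nat).
Local Notation cochain := {ffun {set 'I_n} -> k^o}.
Local Notation sum_coh := (sum_cohomology k Delta (i - 1) j).
Local Notation loc_coh := (local_cohomology k Delta i j).
Local Notation phi :=
  (fun t => @ext_trans k n Delta i j t : {linear ext k Delta i j t -> ext k Delta i j t.+1}).
Implicit Types (c : multidegree Delta j -> cochain) (h : sum_coh).

Definition cocycle_family c := forall U, c U \in cocycles (@coboundary k n Delta)
  (rel_cochains k Delta (cost Delta (supp_set U))) (i - 1).

Lemma cocycle_familyP c :
  cocycle_family c <-> rel_family (i - 1) c /\ forall U, coboundary Delta (c U) = 0.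
Proof.
split=> [cZ|[cC dc] U]; last first.
  by apply/mem_cocycles; split; [apply: cC | apply: dc].
by split=> U; have /mem_cocycles[] := cZ U.
Qed.

Lemma hg_at_linear t a c c' :
  hg_at t (fun U => a *: c U + c' U) = a *: hg_at t c + hg_at t c'.
Proof.
apply/ffunP => rho; rewrite !ffunE scaler_sumr -big_split; apply: eq_bigr => U _ /=.
case: ifP => _; last by rewrite scaler0 addr0.
by rewrite !ffunE scalerDl scalerA.
Qed.

Lemma hg_at_cocycle t c : (j < t)%N -> cocycle_family c ->
  koszul_cocycle i j t (hg_at t c).
Proof.
move=> jt /cocycle_familyP[cC dc]; split; first exact: hg_at_cochains.
rewrite (hg_at_diff jt cC); apply/ffunP => rho; rewrite !ffunE; apply: big1 => U _.
by rewrite dc ffunE scale0r if_same.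
Qed.

Lemma hg_coef_cocycle t f : (j < t)%N -> koszul_cocycle i j t f ->
  cocycle_family (hg_coef t f).
Proof.
move=> jt [fC df]; apply/cocycle_familyP; split; first exact: hg_coef_cochains.
move=> U; rewrite -hg_coef_diff // df; apply/ffunP => rho.
by rewrite !ffunE linear0 if_same.
Qed.

Definition sum_class c : sum_coh := fun U => cohclass _ _ _ (c U).
Definition sum_repr h : multidegree Delta j -> cochain := fun U => sqrepr (h U).

Lemma sum_repr_cocycle h : cocycle_family (sum_repr h).
Proof. by move=> U; apply: sqrepr_in. Qed.

Lemma sum_reprK : cancel sum_repr sum_class.
Proof. by move=> h; apply: functional_extensionality_dep => U; apply: sqreprK. Qed.

Lemma sum_class_linear a c c' : cocycle_family c -> cocycle_family c' ->
  sum_class (fun U => a *: c U + c' U) = a *: sum_class c + sum_class c'.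
Proof.
move=> cZ cZ'; apply: functional_extensionality_dep => U.
exact: cohclass_linear.
Qed.

Lemma cocycle_family_linear a c c' : cocycle_family c -> cocycle_family c' ->
  cocycle_family (fun U => a *: c U + c' U).
Proof. by move=> cZ cZ' U; apply: rpredD (cZ' U); apply: rpredZ. Qed.

(** The bounding cochains, one for each U, are collected into a family by choice. *)
Lemma sum_class_eq c c' : cocycle_family c -> cocycle_family c' ->
  sum_class c = sum_class c' <->
  exists2 b, rel_family (i - 1 - 1) b & forall U, c U - c' U = coboundary Delta (b U).
Proof.
move=> cZ cZ'; split=> [cc'|[b bC cb]]; last first.
  apply: functional_extensionality_dep => U.
  by apply/(cohclass_eq (cZ U) (cZ' U)); exists (b U).
have /choice[b bP] : forall U : multidegree Delta j, exists b, b \in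
    rel_cochains k Delta (cost Delta (supp_set U)) (i - 1 - 1) /\
    c U - c' U = coboundary Delta b.
  move=> U; have := congr1 (fun h : sum_coh => h U) cc'.
  by move/(cohclass_eq (cZ U) (cZ' U)) => [b]; exists b.
by exists b => U; case: (bP U).
Qed.

(** Defined through chosen representatives; [hg_map_class] shows that the choice is immaterial. *)
Definition hg_map h : loc_coh :=
  dirlim_in phi (ext_class i j j.+1 (hg_cochain (sum_repr h))).

(** Two representatives differ by a family of coboundaries, which the chain map [hg_at] turns into a
    Koszul coboundary. *)
Lemma hg_map_class c : cocycle_family c ->
  hg_map (sum_class c) = dirlim_in phi (ext_class i j j.+1 (hg_cochain c)).
Proof.
move=> cZ; have cZ' := sum_repr_cocycle (sum_class c).
apply: (congr1 (dirlim_in phi (t := j.+1))); rewrite !hg_cochainE.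
apply/(ext_class_eq (hg_at_cocycle (ltnSn j) cZ') (hg_at_cocycle (ltnSn j) cZ)).
have [b bC bE] := iffLR (sum_class_eq cZ' cZ) (sum_reprK _).
exists (hg_at j.+1 b); first exact: hg_at_cochains.
rewrite (hg_at_diff _ bC) //.
have -> : (fun U => coboundary Delta (b U)) =
    fun U => -1 *: c U + sum_repr (sum_class c) U.
  by apply: functional_extensionality_dep => U; rewrite scaleN1r addrC bE.
by rewrite hg_at_linear scaleN1r addrC.
Qed.

Lemma hg_map_linear : linear hg_map.
Proof.
move=> a x y; rewrite -[x]sum_reprK -[y]sum_reprK.
have [xZ yZ] := (sum_repr_cocycle x, sum_repr_cocycle y).
rewrite -sum_class_linear // !hg_map_class //; last exact: cocycle_family_linear.
rewrite !hg_cochainE hg_at_linear ext_class_linear; first exact: dirlim_in_linear.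
- exact: hg_at_cocycle.
- exact: hg_at_cocycle.
Qed.
HB.instance Definition _ := GRing.isLinear.Build k sum_coh loc_coh _ hg_map hg_map_linear.

(** Both sides agree at t = j + 1, and [koszul_trans] carries [hg_at t c] to [hg_at t.+1 c]. *)
Lemma dirlim_seq_hg_at c t : (j < t)%N -> cocycle_family c ->
  dirlim_seq phi (ext_class i j j.+1 (hg_cochain c)) t = ext_class i j t (hg_at t c).
Proof.
move=> jt cZ; rewrite hg_cochainE.
apply: (@ev_compatible_seq _ _ phi j.+1 (fun t => ext_class i j t (hg_at t c))) => // s js.
rewrite -koszul_trans_hg_at //; apply: esym.
exact: (ext_trans_class (hg_at_cocycle js cZ)).
Qed.

(** A class that dies in the limit already dies at some stage t > j. There [hg_at t c] is the
    differential of some b, and applying [hg_coef t] exhibits c as the coboundary of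
    [hg_coef t b]. *)
Lemma hg_map_inj : injective hg_map.
Proof.
apply: raddf_inj => h; rewrite -[h in _ -> h = _]sum_reprK -[h in X in X -> _]sum_reprK.
set c := sum_repr h => hg0; have cZ : cocycle_family c by apply: sum_repr_cocycle.
have {hg0} : dirlim_in phi (ext_class i j j.+1 (hg_cochain c)) = 0.
  by rewrite -hg_map_class.
move=> /dirlim_in_eq0[t jt]; rewrite dirlim_seq_hg_at //.
move=> ct0; have := etrans ct0 (esym (ext_class0 k Delta i j t)).
move=> /(ext_class_eq (hg_at_cocycle jt cZ) (koszul_cocycle0 k Delta i j t))[b bC];
  rewrite subr0 => cE.
apply: functional_extensionality_dep => U.
rewrite /sum_class -[RHS](cohclass0 (@coboundary k n Delta)
  (rel_cochains k Delta (cost Delta (supp_set U))) (i - 1)).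
apply/(cohclass_eq (cZ U)); first by rewrite rpred0.
exists (hg_coef t b U); first exact: (hg_coef_cochains bC).
rewrite subr0; apply: etrans _ (hg_coef_diff b U jt).
have /cocycle_familyP[cC _] := cZ.
by rewrite -[in LHS](hg_atK jt cC) cE.
Qed.

(** At a stage t > j the element is the class of a cocycle f. By [koszul_reduce] f is cohomologous
    to a cocycle f' with degrees a <= 0 only, and f' comes from simplicial cocycles by
    [hg_coefK]. *)
Lemma hg_map_surj (x : loc_coh) : exists h, hg_map h = x.
Proof.
have [t [y [jt ->]]] := dirlim_inP x j.+1.
have [f fZ ->] := ext_classP y; have [fC df] := fZ.
have [b bC fbE] := koszul_reduce fC df.
set f' := f - koszul_diff t b in fbE.
have f'Z : koszul_cocycle i j t f'.
  split; last by rewrite koszul_diffB df koszul_diff_diff subr0.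
  by apply: (rpredB fC); have := koszul_diff_cochains bC; rewrite subrK.
have f'_le rho m : SRcoef m (f' rho) != 0 -> (m <= set_mnm t rho)%MM.
  by rewrite fbE; case: ifP => // _; rewrite eqxx.
have f'E := hg_coefK jt (proj1 f'Z) f'_le.
exists (sum_class (hg_coef t f')); have cZ := hg_coef_cocycle jt f'Z.
apply: etrans (hg_map_class cZ) _.
apply: etrans (esym (dirlim_in_seq phi _ jt)) _.
apply: (congr1 (dirlim_in phi (t := t))).
apply: etrans (dirlim_seq_hg_at jt cZ) _; rewrite f'E.
(* The sign is due to f' - f = - d b. *)
apply/(ext_class_eq f'Z fZ); exists (- b).
  by rewrite rpredN.
rewrite /f' addrAC subrr add0r.
by rewrite -[in RHS](sub0r b) koszul_diffB koszul_diff0 sub0r.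
Qed.

Lemma hg_map_bij : bijective hg_map.
Proof.
have [g gK] := choice hg_map_surj.
by exists g => // h; apply: hg_map_inj; rewrite gK.
Qed.

End HochsterGraebeMap.

(** * Equivariance of the Hochster-Graebe map *)

Section Equivariance.
Variables (k : fieldType) (gT : finGroupType) (n : nat) (Delta : simplicial_complex n).
Variables (to : simplicial_action gT Delta) (i : int) (j : nat).
Local Notation cochain := {ffun {set 'I_n} -> k^o}.
Local Notation phi :=
  (fun t => @ext_trans k n Delta i j t : {linear ext k Delta i j t -> ext k Delta i j t.+1}).
Implicit Types (g : gT) (c : multidegree Delta j -> cochain).

Lemma poly_act_mnm g (m : 'X_{1..n}) :
  poly_act to g 'X_[m] = 'X_[act_mnm to g m] :> {mpoly k[n]}.
Proof.
rewrite !mpolyXE_id rmorph_prod [RHS](reindex_inj (@to_inj gT n to g)) /=.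
by apply: eq_bigr => v _; rewrite rmorphXn /= poly_actX mnmE toK.
Qed.

Lemma act_mnmV_set_mnmB g t rho (U : 'X_{1..n}) :
  act_mnm to g^-1%g (set_mnm t (act_face to g rho) - act_mnm to g U)%MM =
  (set_mnm t rho - U)%MM.
Proof. by apply/mnmP => v; rewrite mnmE !mnmBE !mnmE act_faceE invgK toK. Qed.

Lemma act_multidegree_inj g : injective (@act_multidegree gT n Delta to j g).
Proof.
move=> U U' /(congr1 val) /= UU'; apply: val_inj; apply/mnmP => v.
by have := congr1 (fun m : 'X_{1..n} => m (to v g)) UU'; rewrite !mnmE toK.
Qed.

(** The action [sum_act] lifted from classes to families of cochains. *)
Definition sum_pullback g c : multidegree Delta j -> cochain :=
  fun U => pullback to g (c (act_multidegree to g U)).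

Lemma act_face_subset g (s rho : {set 'I_n}) :
  (act_face to g s \subset act_face to g rho) = (s \subset rho).
Proof.
apply/idP/idP => [sub|]; last exact: imsetS.
by have := imsetS (fun v => to v g^-1%g) sub; rewrite -!/(act_face _ _ _) !act_faceK.
Qed.

(** After reindexing by U -> g U, the ring action of g^-1 turns the monomial of g U at g rho into
    that of U at rho. Both sides carry the same orientation sign, that of g on rho. *)
Lemma hg_at_pullback t g c : hg_at t (sum_pullback g c) = koszul_act to g^-1%g (hg_at t c).
Proof.
apply/ffunP => rho; rewrite !ffunE invgK raddf_sum scaler_sumr.
rewrite [RHS](reindex_inj (@act_multidegree_inj g)); apply: eq_bigr => U _ /=.
rewrite supp_act_mnm act_face_subset in_act_face.
case: ifP => _; last by rewrite linear0 scaler0.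
rewrite ffunE linearZ /= SR_act_class poly_act_mnm act_mnmV_set_mnmB.
by rewrite scalerA.
Qed.

Lemma sum_pullback_cocycle g c : cocycle_family i c -> cocycle_family i (sum_pullback g c).
Proof.
move=> cZ U; apply: cohmap_cocycle (cZ (act_multidegree to g U)) => [l b|b].
  exact: pullback_cochains_mnm.
exact: pullback_coboundary.
Qed.

Lemma sum_act_class g c : cocycle_family i c ->
  sum_act to g (sum_class i c) = sum_class i (sum_pullback g c).
Proof.
move=> cZ; apply: functional_extensionality_dep => U.
apply: cohmap_class (cZ (act_multidegree to g U)) => [l b|b].
  exact: pullback_cochains_mnm.
exact: pullback_coboundary.
Qed.

Lemma local_cohomology_act_in g t (x : ext k Delta i j t) :
  local_cohomology_act to g (dirlim_in phi x) = dirlim_in phi (ext_act to g x).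
Proof.
apply: (@dirlim_map_in _ _ phi
  (fun t => @ext_act k gT n Delta to i j g t : {linear _ -> _})) => s y.
exact: ext_act_trans.
Qed.

(* The inverse appears because cochains are pulled back, whereas Hom(K, k[Delta]) is
   acted upon by transport. *)
Lemma hg_map_act g (h : sum_cohomology k Delta (i - 1) j) :
  hg_map (sum_act to g h) = local_cohomology_act to g^-1%g (hg_map h).
Proof.
rewrite -[h]sum_reprK; set c := sum_repr h.
have cZ : cocycle_family i c by apply: sum_repr_cocycle.
have hgE := hg_map_class cZ.
apply: etrans (congr1 (@hg_map k n Delta i j) (sum_act_class g cZ)) _.
apply: etrans (hg_map_class (sum_pullback_cocycle g cZ)) _.
apply: etrans _ (esym (congr1 (local_cohomology_act to g^-1%g) hgE)).
apply: etrans _ (esym (local_cohomology_act_in _ _)).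
apply: (congr1 (dirlim_in phi (t := j.+1))).
rewrite !hg_cochainE hg_at_pullback; apply: esym.
exact: (ext_act_class _ _ (hg_at_cocycle (ltnSn j) cZ)).
Qed.

End Equivariance.

(** * Irreducible characters of a finite abelian group *)

Section Characters.

(** In characteristic 0 the polynomial X^m - 1 is separable, so it has m distinct roots, and among m
    distinct m-th roots of unity one is primitive. *)
Lemma closed_field_prim_root (F : numClosedFieldType) m : (0 < m)%N ->
  exists z : F, m.-primitive_root z.
Proof.
move=> m_gt0; pose p : {poly F} := 'X^m - 1; have [r Dp] := closed_field_poly_normal p.
rewrite (monicP _) ?monicXnsubC // scale1r in Dp.
have rm1 : all m.-unity_root r by apply/allP => z; rewrite -root_prod_XsubC -Dp.
have sz_r : (m < (size r).+1)%N by rewrite -(size_prod_XsubC r id) -Dp size_XnsubC.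
have [|z] := hasP (has_prim_root m_gt0 rm1 _ sz_r); last by exists z.
by rewrite -separable_prod_XsubC -Dp separable_Xn_sub_1 // pnatr_eq0 -lt0n.
Qed.

(** The image under [iota] of a primitive root of unity of order |G| makes k a splitting field.
    Irreducible representations of the abelian group are then one-dimensional, and their trace is
    multiplicative. *)
Lemma irreducible_characterV (R : realType) (k : fieldType) (iota : {rmorphism R[i] -> k})
    (gT : finGroupType) (chi : gT -> k) :
  abelian [set: gT] -> irreducible_character chi ->
  forall g, chi g^-1%g = (chi g)^-1.
Proof.
move=> cGG [m [rG [irrG chiE]]] g.
have [z z_prim] := closed_field_prim_root R[i] (cardG_gt0 [set: gT]).
have iz_prim : #|[set: gT]|.-primitive_root (iota z) by rewrite fmorph_primitive_root.
have := primitive_root_splitting_abelian iz_prim cGG irrG.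
rewrite (abelian_abs_irr _ cGG) => /eqP m1; subst m.
rewrite !chiE repr_mxV ?inE // [rG g]mx11_scalar invmx_scalar !mxtrace_scalar.
by rewrite ?mulr1n.
Qed.

End Characters.

(** * Restriction of a twisted-equivariant isomorphism to isotypic components *)

Section IsotypicIsomorphism.
Variables (k : fieldType) (gT : finGroupType) (N N' : lmodType k).
Variables (act : gT -> {linear N -> N}) (act' : gT -> {linear N' -> N'}).
Variables (f : {linear N -> N'}) (f_bij : bijective f).
Hypothesis f_act : forall g x, f (act g x) = act' g^-1%g (f x).
Variables (chi : gT -> k) (chiV : forall g, chi g^-1%g = (chi g)^-1).

(** The equation g x = chi(g)^-1 x is carried by f to g^-1 f(x) = chi(g^-1) f(x), and g^-1 runs over
    the whole group with g. *)
Lemma isotypic_transport x :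
  (f x \in isotypic_pred act' chi) = (x \in isotypic_pred act (fun g => (chi g)^-1)).
Proof.
apply/forallP/forallP => xN g; last first.
  by rewrite -[g in act' g]invgK -f_act (eqP (xN _)) linearZ /= chiV invrK.
by apply/eqP/(bij_inj f_bij); rewrite f_act (eqP (xN _)) linearZ /= chiV.
Qed.

Lemma isotypic_iso : exists f_chi : {linear isotypic act (fun g => (chi g)^-1)
    -> isotypic act' chi}, bijective f_chi /\ forall x, val (f_chi x) = f (val x).
Proof.
have [f' fK f'K] := f_bij.
have fP (x : isotypic act (fun g => (chi g)^-1)) : f (val x) \in isotypic_pred act' chi.
  by rewrite isotypic_transport; apply: valP.
have f'P (y : isotypic act' chi) : f' (val y) \in isotypic_pred act (fun g => (chi g)^-1).
  by rewrite -isotypic_transport f'K; apply: valP.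
pose f_chi x : isotypic act' chi := Sub (f (val x)) (fP x).
have f_chi_linear : linear f_chi.
  by move=> a x y; apply: val_inj; rewrite !linearP !SubK linearP.
pose f_chiL := GRing.isLinear.Build _ _ _ _ f_chi f_chi_linear.
pose F : {linear _ -> _} := HB.pack f_chi f_chiL.
exists F; split=> [|x]; last exact: SubK.
exists (fun y => Sub (f' (val y)) (f'P y)) => [x|y]; apply: val_inj.
  by rewrite /= fK.
by rewrite /= f'K.
Qed.

End IsotypicIsomorphism.

Theorem theorem3p1 (R : realType) (k : fieldType) (iota : {rmorphism R[i] -> k})
    (n : nat) (Delta : simplicial_complex n)
    (gT : finGroupType) (abelian_gT : abelian [set: gT])
    (to : simplicial_action gT Delta) (free_to : free_action to)
    (i : int) (j : nat) :
  exists hg : {linear sum_cohomology k Delta (i - 1) j -> local_cohomology k Delta i j},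
    [/\ is_hochster_graebe hg,
        bijective hg
      & forall chi : gT -> k, irreducible_character chi ->
        exists hg_chi :
          {linear isotypic (@sum_act gT n Delta to k (i - 1) j) (fun g => (chi g)^-1)
               -> isotypic (@local_cohomology_act k gT n Delta to i j) chi},
          bijective hg_chi /\ forall x, val (hg_chi x) = hg (val x)].
Proof.
exists (@hg_map k n Delta i j : {linear _ -> _}); split.
- by move=> c cZ; apply: hg_map_class.
- exact: hg_map_bij.
(* The identity chi(g^-1) = chi(g)^-1 converts the inverse in [hg_map_act] into the passage from chi
   to its inverse. *)
move=> chi chiP; have chiV := irreducible_characterV iota abelian_gT chiP.
apply: isotypic_iso => //; first exact: hg_map_bij.
by move=> g h; apply: hg_map_act.
Qed.
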